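(* Let $t=\overleftarrow\mu t[-1]$ be an injective-reachable seed satisfying the full rank assumption, and let $z\in LP(t)$ be such that $\overleftarrow\mu^*z\in LP(t[-1])$. Let $\eta\in M^\circ(t)$. Then $z$ is copointed in $LP(t)$ at the codegree $\mathrm{codeg}^tz=\eta$ if and only if $\overleftarrow\mu^*z$ is pointed in $LP(t[-1])$ with degree $\deg^{t[-1]}(\overleftarrow\mu^*z)=\psi_{t[-1],t}\eta$.
   Context: Conventions: $[a]_+=\max(a,0)$, $\mathbb N=\mathbb Z_{\ge 0}$; $\Bbbk=\mathbb Z$ (classical case) or $\Bbbk=\mathbb Z[q^{\pm1/2}]$ (quantum case). Fix a finite set $I=I_{uf}\sqcup I_{f}$ (unfrozen, frozen) and integers $d_i>0$. A seed $t=((b_{ij}(t))_{i,j\in I},(x_i(t))_{i\in I})$ has $b_{ij}d_j=-b_{ji}d_i$, $b_{ij}\in\mathbb Q$ if $i,j\in I_f$ and $b_{ij}\in\mathbb Z$ otherwise, and indeterminates $x_i(t)$. $\tilde B(t)=(b_{ik}(t))_{i\in I,k\in I_{uf}}$. Full rank assumption: $\tilde B(t)$ has rank $|I_{uf}|$ (preserved by mutation). $M^\circ(t)=\mathbb Z^I$ with basis $f_i$; $LP(t)=\Bbbk[M^\circ(t)]$ with basis of Laurent monomials $x(t)^m$, $x_i=x^{f_i}$. Mutation: for $k\in I_{uf}$, $t'=\mu_kt$ has $b'_{ij}=-b_{ij}$ if $k\in\{i,j\}$ and $b'_{ij}=b_{ij}+b_{ik}[b_{kj}]_++[-b_{ik}]_+b_{kj}$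 otherwise; $\mu_k^*$ identifies the (skew-)fields of fractions $\mathcal F(t')\simeq\mathcal F(t)$ by $x_i'\mapsto x_i$ ($i\neq k$), $x_k'\mapsto x^{-f_k+\sum_j[-b_{jk}]_+f_j}+x^{-f_k+\sum_j[b_{jk}]_+f_j}$. In the quantum case, $M^\circ(t)$ carries a skew-symmetric $\mathbb Z$-valued form $\lambda$ with $\lambda(f_i,\tilde B(t)e_k)=-\delta_{ik}d_k'$ ($d_k'>0$ integers), $LP(t)$ has the product $x^m*x^{m'}=q^{\lambda(m,m')/2}x^{m+m'}$, and $\lambda$ is transported to $\mu_kt$ via $f_i'\mapsto f_i$, $f_k'\mapsto-f_k+\sum_j[-b_{jk}]_+f_j$. For $t=\overleftarrow\mu t[-1]$, $\overleftarrow\mu^*:\mathcal F(t)\simeq\mathcal F(t[-1])$ is the composition of the corresponding maps. Tropical transformation $\phi_{\mu_kt,t}:M^\circ(t)\to M^\circ(\mu_kt)$: $g'_k=-g_k$, $g_i'=g_i+[b_{ik}]_+[g_k]_+-[-b_{ik}]_+[-g_k]_+$ ($i\neq k$); $\phi_{t',t}$ is the composition along any mutation sequence. $\psi_{t',t}:M^\circ(t)\to M^\circ(t')$ is the linear map with $\psi_{t',t}(f_i)=\phi_{t',t}(f_i)$ for all $i\in I$. Dominance order: $g'\preceq_tg$ iff $g'=g+\tilde B(t)n$, $n\in\mathbb N^{I_{uf}}$. $z\in LP(t)$ has degree $\deg^tz=g$ (resp. codegree $\mathrm{codeg}^tz=\eta$) if $g$ (resp. $\eta$) is the unique $\prec_t$-maximal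 (resp. $\prec_t$-minimal) Laurent degree of $z$; it is pointed at $g$ (resp. copointed at $\eta$) if moreover the coefficient of that monomial is $1$. Injective-reachability: $t$ is injective-reachable if there are a seed $t[1]$ obtained from $t$ by mutations and a permutation $\sigma$ of $I_{uf}$ with $\deg^t(x_k(t[1]))\in-f_{\sigma(k)}+\mathbb Z^{I_f}$ for all $k\in I_{uf}$ (cluster variables have degrees in every $LP(t)$). If one seed is injective-reachable so are all related seeds; $t[-1]$ denotes a seed with $(t[-1])[1]=t$. *)

(* Defs.v *)
From HB Require Import structures.
From mathcomp Require Import all_boot all_order all_algebra all_fingroup.
From mathcomp Require Import finmap monalg.
From mathcomp Require Import zify ring lra.

Set Implicit Arguments.
Unset Strict Implicit.
Unset Printing Implicit Defensive.

Import Order.TTheory GRing.Theory Num.Theory.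
Local Open Scope fset_scope.
Local Open Scope ring_scope.

(* [c a b] is the factor occurring in the product [x^a * x^b = c a b x^(a+b)]. *)
Record bicharacter (A : zmodType) (k : comNzRingType) := Bicharacter {
  bich :> A -> A -> k;
  bich0l : forall a, bich 0 a = 1;
  bich0r : forall a, bich a 0 = 1;
  bichDl : forall a b e, bich (a + b) e = bich a e * bich b e;
  bichDr : forall a b e, bich a (b + e) = bich a b * bich a e
}.

Definition twisted_algebra (A : zmodType) (k : comNzRingType)
  (c : bicharacter A k) : Type := {malg k[A]}.

Section TwistedAlgebra.
Context (A : zmodType) (k : comNzRingType) (c : bicharacter A k).
Local Notation TA := (twisted_algebra c).
Implicit Types (x y z : {malg k[A]}) (a b : A).

HB.instance Definition _ := GRing.Lmodule.copy TA {malg k[A]}.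

Definition ta_one : {malg k[A]} := << 1 *g 0 >>.

Definition ta_mul x y : {malg k[A]} :=
  \sum_(a <- msupp x) \sum_(b <- msupp y) << x@_a * y@_b * c a b *g a + b >>.

Lemma ta_mulw (d1 d2 : {fset A}) x y :
  msupp x `<=` d1 -> msupp y `<=` d2 ->
  ta_mul x y = \sum_(a <- d1) \sum_(b <- d2) << x@_a * y@_b * c a b *g a + b >>.
Proof.
move=> le1 le2; rewrite /ta_mul (big_fset_incl _ le1) /=; last first.
  move=> a _ /mcoeff_outdom xa.
  by rewrite big1 // => b _; rewrite xa !mul0r monalgU0.
apply/eq_bigr => a _; apply/big_fset_incl => // b _ /mcoeff_outdom ->.
by rewrite mulr0 mul0r monalgU0.
Qed.

Lemma ta_mulDl : left_distributive ta_mul +%R.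
Proof.
move=> x y z.
rewrite (ta_mulw (msuppD_le x y) (fsubset_refl _)).
rewrite (ta_mulw (fsubsetUl (msupp x) (msupp y)) (fsubset_refl _)).
rewrite (ta_mulw (fsubsetUr (msupp x) (msupp y)) (fsubset_refl _)).
rewrite -big_split /=; apply/eq_bigr => a _.
rewrite -big_split /=; apply/eq_bigr => b _.
by rewrite mcoeffD !mulrDl monalgUD.
Qed.

Lemma ta_mulDr : right_distributive ta_mul +%R.
Proof.
move=> z x y.
rewrite (ta_mulw (fsubset_refl _) (msuppD_le x y)).
rewrite (ta_mulw (fsubset_refl _) (fsubsetUl (msupp x) (msupp y))).
rewrite (ta_mulw (fsubset_refl _) (fsubsetUr (msupp x) (msupp y))).
rewrite -big_split /=; apply/eq_bigr => a _.
rewrite -big_split /=; apply/eq_bigr => b _.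
by rewrite mcoeffD mulrDr mulrDl monalgUD.
Qed.

Lemma ta_mul0l : left_zero 0 ta_mul.
Proof. by move=> x; rewrite /ta_mul msupp0 big_seq_fset0. Qed.

Lemma ta_mul0r : right_zero 0 ta_mul.
Proof.
by move=> x; rewrite /ta_mul big1 // => a _; rewrite msupp0 big_seq_fset0.
Qed.

Lemma ta_mulUU (r s : k) a b :
  ta_mul << r *g a >> << s *g b >> = << r * s * c a b *g a + b >>.
Proof. by rewrite (ta_mulw msuppU_le msuppU_le) !big_seq_fset1 !mcoeffUU. Qed.

Lemma ta_mul_suml I (r : seq I) (F : I -> {malg k[A]}) y :
  ta_mul (\sum_(i <- r) F i) y = \sum_(i <- r) ta_mul (F i) y.
Proof. exact: (big_morph (ta_mul^~ y) (fun _ _ => ta_mulDl _ _ _) (ta_mul0l y)). Qed.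

Lemma ta_mul_sumr I (r : seq I) (F : I -> {malg k[A]}) y :
  ta_mul y (\sum_(i <- r) F i) = \sum_(i <- r) ta_mul y (F i).
Proof. exact: (big_morph (ta_mul y) (fun _ _ => ta_mulDr _ _ _) (ta_mul0r y)). Qed.

Lemma ta_mul1l : left_id ta_one ta_mul.
Proof.
move=> x; rewrite [in LHS](monalgE x) ta_mul_sumr [RHS]monalgE.
by apply/eq_bigr => a _; rewrite ta_mulUU bich0l mulr1 mul1r add0r.
Qed.

Lemma ta_mul1r : right_id ta_one ta_mul.
Proof.
move=> x; rewrite [in LHS](monalgE x) ta_mul_suml [RHS]monalgE.
by apply/eq_bigr => a _; rewrite ta_mulUU bich0r !mulr1 addr0.
Qed.

Lemma ta_mulA : associative ta_mul.
Proof.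
move=> x y z; rewrite (monalgE x) !ta_mul_suml; apply/eq_bigr => a _.
move: (x@_a) => r; rewrite (monalgE y) ta_mul_suml !ta_mul_sumr ta_mul_suml.
apply/eq_bigr => b _; move: (y@_b) => s.
rewrite (monalgE z) !ta_mul_sumr; apply/eq_bigr => e _; move: (z@_e) => t.
by rewrite !ta_mulUU bichDr bichDl addrA; congr (<< _ *g _ >>); ring.
Qed.

Lemma ta_one_neq0 : ta_one != 0.
Proof. by rewrite monalgU_eq0 oner_eq0. Qed.

HB.instance Definition _ := GRing.Zmodule_isNzRing.Build TA
  ta_mulA ta_mul1l ta_mul1r ta_mulDl ta_mulDr ta_one_neq0.

Lemma ta_mulE (x y : TA) : x * y = ta_mul x y. Proof. by []. Qed.

End TwistedAlgebra.

Definition trivial_bicharacter : bicharacter int int.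
Proof. by refine (@Bicharacter int int (fun _ _ => 1) _ _ _ _) => *; rewrite ?mulr1. Defined.

(* Z[q^{1/2}, q^{-1/2}]: the basis element [<< n >>] is q^{n/2}. *)
Definition zq := twisted_algebra trivial_bicharacter.

HB.instance Definition _ := GRing.NzRing.on zq.

Lemma zq_mulC : commutative (@GRing.mul zq).
Proof.
move=> x y; rewrite !ta_mulE /ta_mul exchange_big; apply/eq_bigr => a _.
by apply/eq_bigr => b _; rewrite /= !mulr1 mulrC addrC.
Qed.

HB.instance Definition _ := GRing.PzRing_hasCommutativeMul.Build zq zq_mulC.

(* The Laurent polynomial rings are over Z in the classical case and over
   Z[q^{1/2}, q^{-1/2}] in the quantum case, where [d'] gives the multipliers of the compatibility condition
   between the form lambda and the exchange matrix. *)
Variant flavor (J : Type) :=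
  | Classical
  | Quantum (d' : J -> nat) of (forall k, 0 < d' k)%N.
Arguments Classical {J}.

Definition base_ring J (fl : flavor J) : comNzRingType :=
  if fl is Quantum _ _ then zq else int.

(* n |-> q^{n/2}, with q = 1 in the classical case *)
Definition qhalf J (fl : flavor J) : int -> base_ring fl :=
  match fl with
  | Classical => fun=> 1
  | Quantum _ _ => fun n => << n >>
  end.

Lemma qhalf0 J (fl : flavor J) : qhalf fl 0 = 1.
Proof. by case: fl. Qed.

Lemma qhalfD J (fl : flavor J) m n : qhalf fl (m + n) = qhalf fl m * qhalf fl n.
Proof.
case: fl => [|d' d'P] /=; first by rewrite mulr1.
by rewrite ta_mulE ta_mulUU !mulr1.
Qed.

Definition pos (R : realDomainType) (a : R) : R := Num.max a 0.

(* [Ifr] is the set of frozen vertices; [mult i] is the integer d_i. *)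
Record fixed_data := FixedData {
  Iuf : finType;
  Ifr : finType;
  mult : Iuf + Ifr -> nat;
  mult_gt0 : forall i, (0 < mult i)%N;
  flav : flavor Iuf
}.

Section Lattice.
Context (D : fixed_data).

Definition vertex : finType := (Iuf D + Ifr D)%type.
Definition lattice : zmodType := {ffun vertex -> int}.

Definition basis_vec (i : vertex) : lattice := [ffun j => (i == j)%:R].

Definition form (L : vertex -> vertex -> int) (m m' : lattice) : int :=
  \sum_i \sum_j m i * L i j * m' j.

(* The vector B~ e_k; its entries b_ik are integers, k being unfrozen. *)
Definition column (b : vertex -> vertex -> rat) (k : Iuf D) : lattice :=
  [ffun i => Num.floor (b i (inl k))].

Definition frozen (i : vertex) : bool := if i is inr _ then true else false.

Definition compatible (b : vertex -> vertex -> rat) (L : vertex -> vertex -> int) :=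
  match flav D with
  | Classical => forall i j, L i j = 0
  | Quantum d' _ =>
      (forall i j, L i j = - L j i) /\
      (forall i k, form L (basis_vec i) (column b k) =
                   if i == inl k then - (d' k)%:Z else 0)
  end.

(* The lattice M(t) is [lattice] for every seed t, the basis f_i(t) being
   [basis_vec]. [lam i j] is lambda(f_i, f_j); it plays no role, and is set to 0,
   in the classical case. *)
Record seed := Seed {
  exch : vertex -> vertex -> rat;
  lam : vertex -> vertex -> int;
  exch_int : forall i j, ~~ (frozen i && frozen j) -> exch i j \is a Num.int;
  exch_skew : forall i j,
    exch i j * (mult j)%:R = - (exch j i * (mult i)%:R);
  lam_compat : compatible exch lam
}.

Definition mutate_exch (b : vertex -> vertex -> rat) (k : Iuf D) (i j : vertex) : rat :=
  if (i == inl k) || (j == inl k) then - b i j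
  else b i j + b i (inl k) * pos (b (inl k) j) + pos (- b i (inl k)) * b (inl k) j.

(* -f_k + sum_j [-b_jk]_+ f_j and -f_k + sum_j [b_jk]_+ f_j *)
Definition exch_vecN (b : vertex -> vertex -> rat) (k : Iuf D) : lattice :=
  - basis_vec (inl k) + \sum_j basis_vec j *~ pos (- column b k j).
Definition exch_vecP (b : vertex -> vertex -> rat) (k : Iuf D) : lattice :=
  - basis_vec (inl k) + \sum_j basis_vec j *~ pos (column b k j).

(* The image in M(t) of the basis vector f'_i of M(mu_k t). *)
Definition transport (b : vertex -> vertex -> rat) (k : Iuf D) (i : vertex) : lattice :=
  if i == inl k then exch_vecN b k else basis_vec i.

Definition mutate_lam (b : vertex -> vertex -> rat) (L : vertex -> vertex -> int)
    (k : Iuf D) (i j : vertex) : int :=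
  form L (transport b k i) (transport b k j).

End Lattice.

Section Mutation.
Context (D : fixed_data).
Local Notation V := (vertex D).
Local Notation M := (lattice D).
Implicit Types (L : V -> V -> int) (m : M) (b : V -> V -> rat) (k : Iuf D).

Lemma formDl L m1 m2 m : form L (m1 + m2) m = form L m1 m + form L m2 m.
Proof.
rewrite /form -big_split; apply/eq_bigr => i _ /=.
rewrite -big_split; apply/eq_bigr => j _ /=.
by rewrite ffunE !mulrDl.
Qed.

Lemma formDr L m1 m2 m : form L m (m1 + m2) = form L m m1 + form L m m2.
Proof.
rewrite /form -big_split; apply/eq_bigr => i _ /=.
rewrite -big_split; apply/eq_bigr => j _ /=.
by rewrite ffunE !mulrDr.
Qed.

Lemma form0l L m : form L 0 m = 0.
Proof. by apply: (addIr (form L 0 m)); rewrite -formDl !add0r. Qed.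

Lemma form0r L m : form L m 0 = 0.
Proof. by apply: (addIr (form L m 0)); rewrite -formDr !add0r. Qed.

Lemma formZl L m m' (a : int) : form L (m *~ a) m' = form L m m' * a.
Proof.
rewrite /form mulr_suml; apply/eq_bigr => i _.
rewrite mulr_suml; apply/eq_bigr => j _.
by rewrite ffunMzE -mulrzr intz; ring.
Qed.

Lemma formZr L m m' (a : int) : form L m (m' *~ a) = form L m m' * a.
Proof.
rewrite /form mulr_suml; apply/eq_bigr => i _.
rewrite mulr_suml; apply/eq_bigr => j _.
by rewrite ffunMzE -mulrzr intz; ring.
Qed.

Lemma form_suml L I (r : seq I) (F : I -> M) m :
  form L (\sum_(i <- r) F i) m = \sum_(i <- r) form L (F i) m.
Proof. exact: (big_morph (form L ^~ m) (fun _ _ => formDl _ _ _ _) (form0l L m)). Qed.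

Lemma form_sumr L I (r : seq I) (F : I -> M) m :
  form L m (\sum_(i <- r) F i) = \sum_(i <- r) form L m (F i).
Proof. exact: (big_morph (form L m) (fun _ _ => formDr _ _ _ _) (form0r L m)). Qed.

Lemma lattice_basis m : m = \sum_i basis_vec i *~ m i.
Proof.
apply/ffunP => j; rewrite sum_ffunE (bigD1 j) //= big1 => [|i ij].
  by rewrite ffunMzE ffunE eqxx intz addr0.
by rewrite ffunMzE ffunE (negPf ij) mul0rz.
Qed.

Lemma form_basis L i j : form L (basis_vec i) (basis_vec j) = L i j.
Proof.
rewrite /form (bigD1 i) //= [X in _ + X]big1 ?addr0 => [|i' ne]; last first.
  by rewrite big1 // => j' _; rewrite ffunE eq_sym (negPf ne) !mul0r.
rewrite (bigD1 j) //= big1 ?addr0 => [|j' ne].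
  by rewrite !ffunE !eqxx mul1r mulr1.
by rewrite !ffunE [j == _]eq_sym (negPf ne) mulr0.
Qed.

Lemma formC L m m' : (forall i j, L i j = - L j i) -> form L m m' = - form L m' m.
Proof.
move=> LN; rewrite /form exchange_big -sumrN; apply/eq_bigr => i _.
rewrite -sumrN; apply/eq_bigr => j _; rewrite LN; ring.
Qed.

Lemma columnE b k i :
  (forall i j, ~~ (frozen i && frozen j) -> b i j \is a Num.int) ->
  (column b k i)%:~R = b i (inl k).
Proof. by move=> bZ; rewrite ffunE floorK // bZ //= andbF. Qed.

Lemma pos_int (R : realDomainType) (a : int) : (pos a)%:~R = pos (a%:~R : R).
Proof. by rewrite /pos !maxEle -[0 in RHS](mulr0z 1) ler_int; case: ifP. Qed.

Lemma pos_is_int (a : rat) : a \is a Num.int -> pos a \is a Num.int.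
Proof. by rewrite /pos; case: ltP. Qed.

Lemma posMn (R : realDomainType) (a : R) (n : nat) : pos a * n%:R = pos (a * n%:R).
Proof. by rewrite /pos maxr_pMl ?ler0n // mul0r. Qed.

Lemma mutate_exch_int b k :
  (forall i j, ~~ (frozen i && frozen j) -> b i j \is a Num.int) ->
  forall i j, ~~ (frozen i && frozen j) -> mutate_exch b k i j \is a Num.int.
Proof.
move=> bZ i j ij; rewrite /mutate_exch; case: ifP => _; first by rewrite rpredN bZ.
have bk l : b l (inl k) \is a Num.int by rewrite bZ //= andbF.
have kb l : b (inl k) l \is a Num.int by rewrite bZ.
by rewrite !rpredD ?rpredM ?pos_is_int ?rpredN ?bk ?kb ?bZ.
Qed.

Lemma mutate_exch_skew b k :
  (forall i j, b i j * (mult j)%:R = - (b j i * (mult i)%:R)) ->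
  forall i j, mutate_exch b k i j * (mult j)%:R
              = - (mutate_exch b k j i * (mult i)%:R).
Proof.
move=> bS i j; rewrite /mutate_exch orbC; case: ifP => _.
  by rewrite !mulNr bS.
have e1 : b (inl k) j * (mult j)%:R = - (b j (inl k) * (mult (inl k))%:R) by [].
have e2 : b (inl k) i * (mult i)%:R = - (b i (inl k) * (mult (inl k))%:R) by [].
have p1 : pos (b (inl k) j) * (mult j)%:R
          = pos (- b j (inl k)) * (mult (inl k))%:R.
  by rewrite !posMn e1 mulNr.
have p2 : pos (b (inl k) i) * (mult i)%:R
          = pos (- b i (inl k)) * (mult (inl k))%:R.
  by rewrite !posMn e2 mulNr.
rewrite !mulrDl -!mulrA e1 e2 p1 p2 bS; ring.
Qed.

Lemma diag0 b k :
  (forall i j, b i j * (mult j)%:R = - (b j i * (mult i)%:R)) ->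
  b (inl k) (inl k) = 0.
Proof.
move=> /(_ (inl k) (inl k)) e.
have /eqP: b (inl k) (inl k) * (mult (inl k : V))%:R = 0.
  by move: e; move: (_ * _) => u; lra.
by rewrite mulf_eq0 pnatr_eq0 (gtn_eqF (mult_gt0 _)) orbF => /eqP.
Qed.

Definition transport_lin b k (m : M) : M := \sum_i transport b k i *~ m i.

Lemma form_mutate b L k m m' :
  form (mutate_lam b L k) m m' = form L (transport_lin b k m) (transport_lin b k m').
Proof.
rewrite /transport_lin form_suml [LHS]/form; apply/eq_bigr => i _.
rewrite form_sumr; apply/eq_bigr => j _.
by rewrite formZl formZr /mutate_lam; ring.
Qed.

Lemma transport_linE b k m : transport_lin b k m
  = m - basis_vec (inl k) *~ (2 * m (inl k))
    + (\sum_j basis_vec j *~ pos (- column b k j)) *~ m (inl k).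
Proof.
have e : \sum_(i | i != inl k) transport b k i *~ m i
         = \sum_(i | i != inl k) basis_vec i *~ m i.
  by apply/eq_bigr => i /negPf ne; rewrite /transport ne.
rewrite /transport_lin (bigD1 (inl k)) //= e {e} /transport eqxx /exch_vecN.
rewrite [X in _ = X - _ + _](lattice_basis m) [X in _ = X - _ + _](bigD1 (inl k)) //=.
rewrite mulrzDl mulNrz; set A := basis_vec _ *~ m _; set C := \sum_(i | _) _.
set B := (\sum_j _) *~ _; rewrite mulrC mulrzA.
apply/ffunP => i; rewrite !ffunE !ffunMzE; ring.
Qed.

Lemma column_mutate b k l i :
  (forall i j, ~~ (frozen i && frozen j) -> b i j \is a Num.int) ->
  column (mutate_exch b k) l i =
  if (i == inl k) || (l == k) then - column b l i
  else column b l i + column b k i * pos (column b l (inl k))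
       + pos (- column b k i) * column b l (inl k).
Proof.
move=> bZ; apply: (@intr_inj rat).
rewrite columnE; last exact: mutate_exch_int.
rewrite /mutate_exch -[inl l == inl k]/(l == k); case: ifP => _.
  by rewrite rmorphN /= columnE.
by rewrite !rmorphD !rmorphM /= !pos_int rmorphN /= !columnE.
Qed.

Lemma column_diag0 b k :
  (forall i j, b i j * (mult j)%:R = - (b j i * (mult i)%:R)) ->
  column b k (inl k) = 0.
Proof. by move=> bS; rewrite ffunE diag0 // floor0. Qed.

Lemma mutate_column b k j :
  (forall i j, ~~ (frozen i && frozen j) -> b i j \is a Num.int) ->
  (forall i j, b i j * (mult j)%:R = - (b j i * (mult i)%:R)) ->
  transport_lin b k (column (mutate_exch b k) j)
  = if j == k then - column b k
    else column b j + column b k *~ pos (column b j (inl k)).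
Proof.
move=> bZ bS; rewrite transport_linE.
have c0 := column_diag0 k bS.
have E i := column_mutate k j i bZ.
have Ek : j = k -> column b j = column b k by move->.
move: c0 E Ek.
move: (column (mutate_exch b k) j) (column b j) (column b k) => u v w w0 uE Ek.
apply/ffunP => i.
have S : (\sum_l basis_vec l *~ pos (- w l) : M) i = pos (- w i).
  rewrite sum_ffunE (bigD1 i) //= big1 => [|l /negPf ne].
    by rewrite ffunMzE ffunE eqxx intz addr0.
  by rewrite ffunMzE ffunE ne mul0rz.
rewrite !ffunE !ffunMzE S !ffunE !uE eqxx /= [inl k == i]eq_sym.
rewrite ?mulrzz.
case: (eqVneq i (inl k)) => [->|ik] /=; case: (eqVneq j k) => [jk|jk].
- by rewrite Ek // [RHS]ffunE w0; ring.
- by rewrite [RHS]ffunE ffunMzE w0 mul0rz oppr0 /pos maxxx; ring.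
- by rewrite Ek // [RHS]ffunE w0; ring.
- by rewrite [RHS]ffunE ffunMzE mulrzz; ring.
Qed.

Lemma transport_basis b k i : transport_lin b k (basis_vec i) = transport b k i.
Proof.
rewrite /transport_lin (bigD1 i) //= big1 => [|j /negPf ne].
  by rewrite ffunE eqxx addr0.
by rewrite ffunE eq_sym ne mulr0z.
Qed.

Lemma mutate_compat b L k :
  (forall i j, ~~ (frozen i && frozen j) -> b i j \is a Num.int) ->
  (forall i j, b i j * (mult j)%:R = - (b j i * (mult i)%:R)) ->
  compatible b L -> compatible (mutate_exch b k) (mutate_lam b L k).
Proof.
move=> bZ bS; rewrite /compatible; case: (flav D) => [L0 i j|d' d'P [LN LB]].
  by rewrite /mutate_lam /form big1 // => i' _; rewrite big1 // => j' _;
     rewrite L0 mulr0 mul0r.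
split=> [i j|i j]; first exact: formC.
have LBk : form L (\sum_l basis_vec l *~ pos (- column b k l)) (column b k) = 0.
  rewrite form_suml big1 // => l _; rewrite formZl LB.
  by case: eqP => [->|_]; rewrite ?column_diag0 // ?mul0r // oppr0 /pos maxxx mulr0.
have LBj l : form L (\sum_l basis_vec l *~ pos (- column b k l)) (column b l)
    = - pos (- column b k (inl l)) * (d' l)%:Z.
  rewrite form_suml (bigD1 (inl l)) //= big1 ?addr0 => [|v /negPf ne].
    by rewrite formZl LB eqxx; ring.
  by rewrite formZl LB ne mul0r.
have BL l : form L (column b k) (column b l) = - (column b k (inl l)) * (d' l)%:Z.
  rewrite [X in form L X _]lattice_basis form_suml (bigD1 (inl l)) //= big1 => [|v /negPf ne].
    by rewrite formZl LB eqxx addr0; ring.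
  by rewrite formZl LB ne mul0r.
have BS l : column b k (inl l) * (d' l)%:Z = - (column b l (inl k) * (d' k)%:Z).
  have := formC (column b k) (column b l) LN; rewrite BL.
  rewrite [X in _ = - form L X _]lattice_basis form_suml (bigD1 (inl k)) //=.
  rewrite big1 => [|v /negPf ne]; last by rewrite formZl LB ne mul0r.
  by rewrite formZl LB eqxx addr0 => e; lia.
rewrite form_mutate transport_basis mutate_column // /transport.
have N x y : form L x (- y) = - form L x y.
  by rewrite -[- y]/(y *~ -1) formZr mulrN1.
have N' x y : form L (- x) y = - form L x y.
  by rewrite -[- x]/(x *~ -1) formZl mulrN1.
case: (eqVneq j k) => [jk|jk]; case: (eqVneq i (inl k)) => [ik|ik]; rewrite ?jk ?ik.
- by rewrite eqxx N formDl N' LBk LB eqxx addr0 opprK.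
- by rewrite (negPf ik) N LB (negPf ik) oppr0.
- rewrite [in RHS](_ : inl k == inl j = false); last first.
    by apply/negP => /eqP [e]; rewrite e eqxx in jk.
  rewrite formDr formZr !formDl !N' !LB eqxx LBk LBj addr0.
  rewrite (_ : inl k == inl j = false); last first.
    by apply/negP => /eqP [e]; rewrite e eqxx in jk.
  have e : pos (- column b k (inl j)) * (d' j)%:Z = pos (column b j (inl k)) * (d' k)%:Z.
    have := posMn (- column b k (inl j)) (d' j); rewrite mulNr.
    by rewrite !natz BS opprK -!natz -posMn.
  by rewrite oppr0 add0r mulNr e; ring.
- by rewrite formDr formZr !LB (negPf ik) mul0r addr0.
Qed.

Definition mutate k (t : seed D) : seed D :=
  Seed (mutate_exch_int k (@exch_int D t)) (mutate_exch_skew k (@exch_skew D t))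
       (mutate_compat k (@exch_int D t) (@exch_skew D t) (@lam_compat D t)).
End Mutation.

Section Laurent.
Context (D : fixed_data).
Local Notation M := (lattice D).

Definition seed_bicharacter (t : seed D) : bicharacter M (base_ring (flav D)).
Proof.
refine (@Bicharacter M _ (fun m m' => qhalf (flav D) (form (lam t) m m')) _ _ _ _).
- by move=> m; rewrite form0l qhalf0.
- by move=> m; rewrite form0r qhalf0.
- by move=> m m' m''; rewrite formDl qhalfD.
- by move=> m m' m''; rewrite formDr qhalfD.
Defined.

Definition LP (t : seed D) := twisted_algebra (seed_bicharacter t).
HB.instance Definition _ t := GRing.NzRing.on (LP t).

Definition monomial (t : seed D) (m : M) : LP t := << m >>.
Definition scalar (t : seed D) (c : base_ring (flav D)) : LP t := << c *g 0 >>.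

Definition full_rank (t : seed D) : Prop :=
  \rank (\matrix_(i < #|vertex D|, k < #|Iuf D|)
           exch t (enum_val i) (inl (enum_val k))) = #|Iuf D|.

End Laurent.

(* A skew-field of (right) fractions of R; it is unique up to a unique
   isomorphism over R. *)
Record skew_fractions (R : nzRingType) := SkewFractions {
  frac :> unitRingType;
  frac_unit : forall x : frac, x != 0 -> x \is a GRing.unit;
  emb : {rmorphism R -> frac};
  emb_inj : injective emb;
  fracP : forall x, exists a b, b != 0 /\ x = emb a * (emb b)^-1
}.

Section MutationMaps.
Context (D : fixed_data) (F : forall t : seed D, skew_fractions (LP t)).

(* mu_k^* : Frac LP(mu_k t) -> Frac LP(t); [mu_scalar] says that it is linear over
   the base ring, so that these conditions determine it. *)
Record mutation_iso (k : Iuf D) (t : seed D) := MutationIso {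
  mu_map :> {rmorphism F (mutate k t) -> F t};
  mu_bij : bijective mu_map;
  mu_scalar : forall c,
    mu_map (emb (F (mutate k t)) (scalar (mutate k t) c)) = emb (F t) (scalar t c);
  mu_var : forall i, i != inl k ->
    mu_map (emb (F (mutate k t)) (monomial (mutate k t) (basis_vec i)))
    = emb (F t) (monomial t (basis_vec i));
  mu_exch :
    mu_map (emb (F (mutate k t)) (monomial (mutate k t) (basis_vec (inl k))))
    = emb (F t) (monomial t (exch_vecN (exch t) k) + monomial t (exch_vecP (exch t) k))
}.

(* [mutate_seq s [:: k1; ..; kl]] is mu_kl .. mu_k1 s. *)
Fixpoint mutate_seq (s : seed D) (ks : seq (Iuf D)) : seed D :=
  if ks is k :: ks' then mutate_seq (mutate k s) ks' else s.

(* The composite mu_k1^* .. mu_kl^*. *)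
Fixpoint mu_seq (mu : forall k t, mutation_iso k t) (s : seed D)
    (ks : seq (Iuf D)) {struct ks} : F (mutate_seq s ks) -> F s :=
  match ks return F (mutate_seq s ks) -> F s with
  | [::] => fun x => x
  | k :: ks' => fun x => mu k s (@mu_seq mu (mutate k s) ks' x)
  end.

End MutationMaps.
Arguments mu_seq {D F} mu s ks x.

Section Degrees.
Context (D : fixed_data).
Local Notation M := (lattice D).
Implicit Types (t : seed D) (g : M).

(* [dom_le t g' g] is g' <=_t g. *)
Definition dom_le t (g' g : M) : Prop :=
  exists n : Iuf D -> nat, g' = g + \sum_k column (exch t) k *+ n k.

Definition dom_lt t (g' g : M) : Prop := dom_le t g' g /\ g' <> g.

Definition maximal_degree t (z : LP t) (g : M) : Prop :=
  g \in msupp z /\ forall g', g' \in msupp z -> ~ dom_lt t g g'.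

Definition minimal_degree t (z : LP t) (g : M) : Prop :=
  g \in msupp z /\ forall g', g' \in msupp z -> ~ dom_lt t g' g.

Definition has_degree t (z : LP t) (g : M) : Prop :=
  maximal_degree z g /\ forall g', maximal_degree z g' -> g' = g.

Definition has_codegree t (z : LP t) (g : M) : Prop :=
  minimal_degree z g /\ forall g', minimal_degree z g' -> g' = g.

Definition pointed t (z : LP t) (g : M) : Prop := has_degree z g /\ z@_g = 1.

Definition copointed t (z : LP t) (g : M) : Prop := has_codegree z g /\ z@_g = 1.

(* phi_{mu_k t, t} *)
Definition trop (k : Iuf D) t (g : M) : M :=
  [ffun i => if i == inl k then - g i
             else g i + pos (column (exch t) k i) * pos (g (inl k))
                  - pos (- column (exch t) k i) * pos (- g (inl k))].

(* phi_{t', t} for t' = mutate_seq t ks *)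
Fixpoint trop_seq t (ks : seq (Iuf D)) (g : M) : M :=
  if ks is k :: ks' then trop_seq (mutate k t) ks' (trop k t g) else g.

(* psi_{t', t} for t' = mutate_seq t ks *)
Definition psi t (ks : seq (Iuf D)) (m : M) : M :=
  \sum_i trop_seq t ks (basis_vec i) *~ m i.

End Degrees.

Section InjectiveReachable.
Context (D : fixed_data) (F : forall t : seed D, skew_fractions (LP t)).
Context (mu : forall k t, mutation_iso F k t).

(* [mutate_seq t ks] is a seed t[1]; the element [z] is the Laurent expansion in t
   of the cluster variable x_k(t[1]). *)
Definition is_shift (t : seed D) (ks : seq (Iuf D)) : Prop :=
  exists sigma : {perm Iuf D}, forall k : Iuf D,
  exists (z : LP t) (g : lattice D),
    [/\ emb (F t) z = mu_seq mu t ks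
          (emb (F (mutate_seq t ks)) (monomial (mutate_seq t ks) (basis_vec (inl k)))),
        has_degree z g
      & exists h : Ifr D -> int,
          g = - basis_vec (inl (sigma k)) + \sum_j basis_vec (inr j) *~ h j].

Definition injective_reachable (t : seed D) : Prop := exists ks, is_shift t ks.

End InjectiveReachable.

(* Main.v *)
(* Fix a total group order on the exponents of LP(t[-1]). At each mutation the two
   monomials of the exchange relation have distinct leading exponents, so the leading
   term of x_k' is one of them; hence every Laurent monomial x(t)^m has a leading term
   x^(G m) with coefficient 1, where G is a product of explicit linear involutions, one
   per mutation, each selected by the sign of a column of the exchange matrix.

   If the order refines the dominance order then G f_i is the degree of x_i(t), whatever
   the order. If the order moreover begins with a linear form l whose value on the k-th
   column of B~ is w_k m_k, with w_k d_k constant, then the signs selecting the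
   involutions are those selecting the branches of the tropical transformations applied
   to m, so that G phi_{t,t[-1]}(m) = m, and l(G B~(t) e_k) = w_k phi_{t,t[-1]}(m)_k.
   Taking for m the degree of x_i(t), whose unfrozen part is -f_sigma(i), gives
   phi_{t[-1],t}(f_i) = G f_i, that is psi = G, and, the coefficients of G B~(t) e_k on
   the columns of B~(t[-1]) being integers, G B~(t) e_k = -B~(t[-1]) e_sigma(k). Thus psi
   reverses the dominance orders. No sign-coherence is needed.

   To conclude, multiply z by a monomial x(t)^p with p large: z x(t)^p is then a
   combination of products of cluster variables of t, which are pointed in LP(t[-1]). *)
From HB Require Import structures.
Require Import Defs.
From mathcomp Require Import all_boot all_order all_algebra all_fingroup.
From mathcomp Require Import finmap monalg.
From mathcomp Require Import zify ring.
From Stdlib Require Import Classical IndefiniteDescription.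
(* mathcomp's [form] would otherwise shadow the one of [Defs]. *)
Import Defs.

Set Implicit Arguments.
Unset Strict Implicit.
Unset Printing Implicit Defensive.

Import Order.TTheory GRing.Theory Num.Theory.
Local Open Scope ring_scope.

(** * Pointed cones in abelian groups and total group orders *)

Section Cones.
Context (A : zmodType).
Implicit Types (P : A -> Prop) (S : pred A) (a b : A).

Definition pointed_cone P : Prop :=
  [/\ P 0, forall a b, P a -> P b -> P (a + b)
    & forall a, P a -> P (- a) -> a = 0].

(* The nonnegative elements for a total group order. *)
Definition total_cone S : Prop :=
  pointed_cone (fun a => S a) /\ forall a, S a || S (- a).

Lemma cone_sum0 P a b : pointed_cone P -> P a -> P b -> a + b = 0 -> a = 0.
Proof. by case=> _ _ PN Pa Pb ab; apply: PN => //; rewrite (addr0_eq ab). Qed.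

Lemma total_cone_max S (s : seq A) : total_cone S -> s != [::] ->
  exists2 g, g \in s & forall h, h \in s -> S (g - h).
Proof.
case=> [[S0 SD _] ST]; elim: s => // a s IH _.
have [->|/IH [g gs gmax]] := eqVneq s [::].
  by exists a => [|h]; rewrite ?mem_head // inE => /eqP ->; rewrite subrr.
have [Sga|Sag] := boolP (S (g - a)).
  by exists g => [|h]; rewrite inE ?gs ?orbT // => /predU1P [->|/gmax].
have {}Sag : S (a - g) by have := ST (g - a); rewrite (negPf Sag) opprB.
exists a => [|h]; rewrite ?mem_head // inE => /predU1P [->|/gmax Sgh].
  by rewrite subrr.
by rewrite -(subrKA g); apply: SD.
Qed.

End Cones.

(** * Extremal terms in a twisted group algebra, relative to a cone *)

Section Tops.
Context (A : zmodType) (k : comNzRingType) (c : bicharacter A k).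
Local Notation TA := (twisted_algebra c).
Implicit Types (x y : TA) (r s : k) (g h a b : A) (P : A -> Prop).

(** Serves for total orders and for dominance orders alike. The coefficient [r] may be 0, so [g]
    need not lie in the support. *)
Definition topped P x r g : Prop :=
  x@_g = r /\ forall h, h \in msupp x -> P (g - h).

Lemma coef_mul x y g : (x * y : TA)@_g =
  \sum_(a <- msupp x) \sum_(b <- msupp y)
     (x@_a * y@_b * c a b) *+ (a + b == g).
Proof.
rewrite ta_mulE /ta_mul raddf_sum; apply/eq_bigr => a _ /=.
by rewrite raddf_sum; apply/eq_bigr => b _ /=; rewrite mcoeffU.
Qed.

Lemma msupp_mul x y g : g \in msupp (x * y : TA) ->
  exists a b, [/\ a \in msupp x, b \in msupp y & g = a + b].
Proof.
rewrite -mcoeff_neq0 => xyg; apply: NNPP => no; case/eqP: xyg.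
rewrite coef_mul big_seq big1 // => a ax.
rewrite big_seq big1 // => b yb; case: eqP => // ab.
by case: no; exists a, b.
Qed.

(** At most one pair of exponents contributes. If [g] or [h] is outside its support, none does and
    both sides vanish. *)
Lemma coef_mul_unique x y g h :
  (forall a b, a \in msupp x -> b \in msupp y -> a + b = g + h -> a = g) ->
  (x * y : TA)@_(g + h) = x@_g * y@_h * c g h.
Proof.
move=> uniq; rewrite coef_mul.
have inner a : a \in msupp x -> \sum_(b <- msupp y)
    (x@_a * y@_b * c a b) *+ (a + b == g + h)
    = (x@_g * y@_h * c g h) *+ (a == g).
  move=> ax; have [->|ag] := eqVneq a g; last first.
    rewrite big_seq big1 // => b yb; case: eqP => // /(uniq _ _ ax yb) e.
    by rewrite e eqxx in ag.
  have [yh|yh] := boolP (h \in msupp y).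
    rewrite (big_fsetD1 h) //= eqxx big_seq big1 ?addr0 // => b.
    rewrite in_fsetD1 => /andP [bh _]; case: eqP => // /addrI e.
    by rewrite e eqxx in bh.
  rewrite (mcoeff_outdom yh) mulr0 mul0r big_seq big1 // => b yb.
  by case: eqP => // /addrI e; rewrite -e yb in yh.
rewrite big_seq (eq_bigr _ inner) -big_seq.
have [xg|xg] := boolP (g \in msupp x).
  rewrite (big_fsetD1 g) //= eqxx big_seq big1 ?addr0 // => b.
  by rewrite in_fsetD1 => /andP [/negPf ->]; rewrite mulr0n.
rewrite (mcoeff_outdom xg) !mul0r big1 // => b _; by rewrite mul0rn.
Qed.

Lemma topped_mul P x y r s g h : pointed_cone P ->
  topped P x r g -> topped P y s h -> topped P (x * y : TA) (r * s * c g h) (g + h).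
Proof.
move=> cP [xg xP] [yh yP]; split=> [|d /msupp_mul [a [b [ax yb ->]]]].
  rewrite coef_mul_unique ?xg ?yh // => a b /xP Pa /yP Pb ab.
  apply/esym/eqP; rewrite -subr_eq0; apply/eqP; apply: (cone_sum0 cP Pa Pb).
  by rewrite addrACA -opprD ab subrr.
by rewrite opprD addrACA; case: cP => _ PD _; apply: PD; [apply: xP|apply: yP].
Qed.

Lemma topped_monomial P g : P 0 -> topped P (<< g >> : TA) 1 g.
Proof.
move=> P0; split=> [|h]; first by rewrite mcoeffUU.
by rewrite msuppU oner_eq0 inE => /eqP ->; rewrite subrr.
Qed.

Lemma bich_unit a b : exists r, r * c a b = 1.
Proof. by exists (c (- a) b); rewrite -bichDl addNr bich0l. Qed.

Lemma bich_cancel a b r s : r * c a b = s * c a b -> r = s.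
Proof.
have [u uP] := bich_unit a b => /(congr1 ( *%R u)).
by rewrite ![u * (_ * _)]mulrCA uP !mulr1.
Qed.

End Tops.

(** * Leading terms for a total order, extended to the skew field of fractions *)

Section LeadingTerms.
Context (A : zmodType) (k : comNzRingType) (c : bicharacter A k).
Local Notation TA := (twisted_algebra c).
Context (K : skew_fractions TA).
Context (S : pred A) (S_total : total_cone S).
Implicit Types (a b u v : TA) (x y : K) (r s : k) (g h : A).

Lemma emb_eq0 a : (emb K a == 0) = (a == 0).
Proof. by rewrite -(inj_eq (@emb_inj _ K)) rmorph0. Qed.

Lemma twisted_mulIr a b u : u != 0 -> a * u = b * u -> a = b.
Proof.
move=> u0 /(congr1 (emb K)); rewrite !rmorphM => /mulIr e.
by apply: (@emb_inj _ K); apply: e; apply: frac_unit; rewrite emb_eq0.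
Qed.

Lemma twisted_mulf_neq0 a b : a != 0 -> b != 0 -> a * b != 0.
Proof.
by move=> a0 b0; apply: contra_neq a0 => ab; apply: (twisted_mulIr b0); rewrite mul0r.
Qed.

(** [k] is a domain because its copy in degree 0 lies in the twisted algebra, which embeds in a skew
    field. *)
Lemma scalar_mulf_neq0 r s : r != 0 -> s != 0 -> r * s != 0.
Proof.
move=> r0 s0; have: (<< r *g 0 >> : TA) * (<< s *g 0 >> : TA) != 0.
  by apply: twisted_mulf_neq0; rewrite monalgU_eq0.
by rewrite ta_mulE ta_mulUU bich0l mulr1 monalgU_eq0.
Qed.

(** Writing [b^-1 a] as a right fraction [p q^-1] gives the common right multiple. *)
Lemma right_ore a b : a != 0 -> b != 0 ->
  exists p q, [/\ p != 0, q != 0 & a * q = b * p].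
Proof.
move=> a0 b0; have [p [q [q0 e]]] := fracP ((emb K b)^-1 * emb K a).
have bU : emb K b \is a GRing.unit by rewrite frac_unit ?emb_eq0.
have qU : emb K q \is a GRing.unit by rewrite frac_unit ?emb_eq0.
have aqbp : a * q = b * p.
  apply: (@emb_inj _ K); rewrite !rmorphM.
  by rewrite -(mulrVK qU (emb K p)) -e mulrA mulVKr.
exists p, q; split=> //; apply: contra_neq (twisted_mulf_neq0 a0 q0) => p0.
by rewrite aqbp p0 mulr0.
Qed.

(** The leading term is kept as an element of the algebra, so that products of terms carry the twist
    by [c]. *)
Definition leading a u : Prop := exists r g,
  [/\ r != 0, u = << r *g g >> & topped (fun h => S h) a r g].

Lemma leading_neq0 a u : leading a u -> a != 0.
Proof.
by case=> r [g [r0 _ [ag _]]]; apply: contra_neq r0 => a0; rewrite -ag a0 mcoeff0.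
Qed.

Lemma leading_term_neq0 a u : leading a u -> u != 0.
Proof. by case=> r [g [r0 -> _]]; rewrite monalgU_eq0. Qed.

Lemma leading_mul a b u v : leading a u -> leading b v -> leading (a * b) (u * v).
Proof.
case=> r [g [r0 -> ta]] [s [h [s0 -> tb]]].
exists (r * s * c g h), (g + h); split.
- have [t tP] := bich_unit c g h; apply: contra_neq (scalar_mulf_neq0 r0 s0) => e.
  by rewrite -[r * s]mulr1 -tP mulrCA e mulr0.
- by rewrite ta_mulE ta_mulUU.
- by apply: topped_mul => //; case: S_total.
Qed.

Lemma leading_exists a : a != 0 -> exists u, leading a u.
Proof.
move=> a0; have sa : (msupp a : seq A) != [::].
  apply: contra_neq a0 => sa; apply/malgP => h; rewrite mcoeff0 mcoeff_outdom //.
  by rewrite -[_ \in msupp a]/(h \in (msupp a : seq A)) sa.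
have [g ga gmax] := total_cone_max S_total sa.
exists << a@_g *g g >>, a@_g, g; split=> //; by rewrite mcoeff_neq0.
Qed.

Lemma leading_unique a u v : leading a u -> leading a v -> u = v.
Proof.
case=> r [g [r0 -> [ag aS]]] [s [h [s0 -> [ah aS']]]].
suff e : g = h by rewrite -ag -ah e.
apply/eqP; rewrite -subr_eq0; apply/eqP.
case: S_total => -[_ _ SN] _; apply: SN; first by apply: aS; rewrite -mcoeff_neq0 ah.
by rewrite opprB; apply: aS'; rewrite -mcoeff_neq0 ag.
Qed.

Lemma leading_monomial g : leading (<< g >> : TA) << g >>.
Proof.
exists 1, g; split; rewrite ?oner_eq0 //.
by apply: topped_monomial; case: S_total => -[].
Qed.

Lemma leading_add a b r s g h : leading a << r *g g >> -> leading b << s *g h >> ->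
  S (g - h) -> g != h -> leading (a + b) << r *g g >>.
Proof.
case: S_total => -[S0 SD SN] _.
case=> r1 [g1 [r10 e1 [ag aS]]] [s1 [h1 [s10 e2 [bh bS]]]] Sgh gh.
have inj1 (r2 r3 : k) (g2 g3 : A) : r3 != 0 ->
    (<< r2 *g g2 >> : {malg k[A]}) = << r3 *g g3 >> -> g2 = g3.
  move=> r30 /(congr1 (mcoeff g3)); rewrite mcoeffUU mcoeffU.
  by case: eqP => // _ /esym/eqP; rewrite mulr0n (negPf r30).
have Eg := inj1 _ _ _ _ r10 e1; have Eh := inj1 _ _ _ _ s10 e2; subst g1 h1.
have Er : r = r1 by move/(congr1 (mcoeff g)): e1; rewrite !mcoeffUU.
rewrite Er; exists (a@_g), g; split; rewrite ?Er ?ag //; split=> [|d].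
  rewrite mcoeffD ag mcoeff_outdom ?addr0 //; apply/negP => /bS Shg.
  by case/eqP: gh; apply/eqP; rewrite -subr_eq0 (SN _ Sgh) // opprB.
move=> /(fsubsetP (msuppD_le _ _)); rewrite in_fsetU => /orP [/aS //|/bS Sd].
by rewrite -(subrKA h); apply: SD.
Qed.

(** Leading terms are multiplicative and unique, so they inherit the Ore relation. This puts
    fractions over a common denominator while tracking leading terms. *)
Lemma leading_ore a b u v : leading a u -> leading b v -> exists p q w w',
  [/\ leading p w', leading q w, a * q = b * p & u * w = v * w'].
Proof.
move=> au bv; have [p [q [p0 q0 aqbp]]] := right_ore (leading_neq0 au) (leading_neq0 bv).
have [w qw] := leading_exists q0; have [w' pw'] := leading_exists p0.
exists p, q, w, w'; split=> //.
by apply: (leading_unique (a := a * q)); [|rewrite aqbp]; apply: leading_mul.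
Qed.

(* [x = a b^-1] with the leading term of [a] equal to [u] times that of [b]. *)
Definition frac_leading x u : Prop := exists a b v,
  [/\ leading b v, leading a (u * v) & x * emb K b = emb K a].

Lemma leading_one : leading 1 1.
Proof. exact: leading_monomial. Qed.

Lemma frac_leading_emb a u : leading a u -> frac_leading (emb K a) u.
Proof.
by move=> au; exists a, 1, 1; rewrite rmorph1 !mulr1; split=> //; apply: leading_one.
Qed.

Lemma frac_leading_mul x y u v :
  frac_leading x u -> frac_leading y v -> frac_leading (x * y) (u * v).
Proof.
case=> a [b [w [bw au xb]]] [d [e [w' [ew dv ye]]]].
have [p [q [z [z' [pz qz dq E]]]]] := leading_ore dv bw.
exists (a * p), (e * q), (w' * z); split; first exact: leading_mul.
  by rewrite -mulrA [v * _]mulrA E mulrA; apply: leading_mul.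
by rewrite !rmorphM !mulrA -[x * y * _]mulrA ye -xb -!mulrA -!rmorphM dq.
Qed.

(** Gives the leading terms of inverses and quotients without inverting a term inside the
    algebra. *)
Lemma frac_leading_div x y u v :
  frac_leading y v -> frac_leading (x * y) (u * v) -> frac_leading x u.
Proof.
case=> d [e [w' [ew dv ye]]] [a [b [w [bw au xyb]]]].
have [p [q [z [z' [pz qz eq E]]]]] := leading_ore ew bw.
exists (a * p), (d * q), (v * w' * z); split; first exact: leading_mul.
  by rewrite -[v * w' * z]mulrA E !mulrA; apply: leading_mul.
by rewrite !rmorphM -xyb -ye -!mulrA -!rmorphM eq.
Qed.

Lemma frac_leading_unique x u v : frac_leading x u -> frac_leading x v -> u = v.
Proof.
case=> a [b [w [bw au xb]]] [d [e [w' [ew dv xe]]]].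
have [p [q [z [z' [pz qz eq E]]]]] := leading_ore ew bw.
have E' : d * q = a * p.
  by apply: (@emb_inj _ K); rewrite !rmorphM -xb -xe -!mulrA -!rmorphM eq.
apply: (twisted_mulIr (u := w * z')).
  by apply: twisted_mulf_neq0; apply: leading_term_neq0; eassumption.
apply: (leading_unique (a := a * p)); first by rewrite mulrA; apply: leading_mul.
by rewrite -E -E' mulrA; apply: leading_mul.
Qed.

Lemma frac_leading_add x y r s g h :
  frac_leading x << r *g g >> -> frac_leading y << s *g h >> ->
  S (g - h) -> g != h -> frac_leading (x + y) << r *g g >>.
Proof.
case=> a [b [w [bw au xb]]] [d [e [w' [ew dv ye]]]] Sgh gh.
have [p [q [z [z' [pz qz eq E]]]]] := leading_ore ew bw.
exists (a * p + d * q), (b * p), (w * z'); split; first exact: leading_mul.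
  have := leading_mul au pz; have := leading_mul dv qz; rewrite -!mulrA E.
  (* The common factor [w * z'] is a single term, so it shifts both exponents by the same [m] and
     keeps their comparison. *)
  have [t [m [_ -> _]]] := leading_mul bw pz.
  rewrite !ta_mulE !ta_mulUU => l1 l2; apply: leading_add l2 l1 _ _.
    by rewrite opprD addrACA subrr addr0.
  by apply: contra_neq gh => /addIr.
rewrite rmorphD mulrDl; congr (_ + _); first by rewrite !rmorphM mulrA xb.
by rewrite -eq !rmorphM mulrA ye.
Qed.

End LeadingTerms.

Arguments frac_leading_emb {A k c K S} S_total {a u}.
Arguments leading_one {A k c S}.

(** * Linear branches of one mutation, and their effect on forms and columns *)

Section Flip.
Context (D : fixed_data).
Local Notation V := (vertex D).
Local Notation M := (lattice D).
Implicit Types (t : seed D) (k j : Iuf D) (m : M) (e : bool).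

Local Notation col t k := (column (exch t) k).

(* The linear map of lattices [M(mu_k t) -> M(t)] tropicalizing [mu_k^*] when the
   monomial [exch_vecP] (for [e = true]) or [exch_vecN] dominates in [x_k']. *)
Definition flip e t k m : M :=
  [ffun i => if i == inl k then - m i
             else m i + pos (if e then col t k i else - col t k i) * m (inl k)].

Lemma flipK e t k : involutive (flip e t k).
Proof.
move=> m; apply/ffunP => i; rewrite !ffunE eqxx.
by case: eqP => [->|_]; rewrite ?opprK // mulrN addrK.
Qed.

Lemma flip_is_additive e t k : zmod_morphism (flip e t k).
Proof.
move=> m m'; apply/ffunP => i; rewrite !ffunE.
case: eqP => [->|_]; first by rewrite opprD.
by rewrite mulrDr mulrN opprD addrACA.
Qed.

HB.instance Definition _ e t k :=
  GRing.isZmodMorphism.Build M M (flip e t k) (flip_is_additive e t k).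

Lemma col_diag t k : col t k (inl k) = 0.
Proof. exact/column_diag0/exch_skew. Qed.

Lemma sum_basis (f : V -> int) : \sum_i basis_vec i *~ f i = [ffun i => f i] :> M.
Proof.
by rewrite [RHS]lattice_basis; apply/eq_bigr => i _; rewrite ffunE.
Qed.

Lemma flip_transport t k m : flip false t k m = transport_lin (exch t) k m.
Proof.
rewrite transport_linE (sum_basis (fun i => pos (- col t k i))).
apply/ffunP => i; rewrite !ffunE !ffunMzE !ffunE eq_sym.
rewrite !mulrzz; case: eqP => [<-|_]; last by rewrite mul0r subr0.
move: (col_diag t k); rewrite ffunE => ->; rewrite oppr0 /pos maxxx -[true%:R]/(1%:R); ring.
Qed.

Lemma pos_subN (R : realDomainType) (a : R) : pos a - pos (- a) = a.
Proof.
by rewrite /pos !maxEle oppr_le0; case: ltrgt0P => [_|_|->]; rewrite ?subr0 ?sub0r ?opprK.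
Qed.

Lemma pos_ge0 (R : realDomainType) (a : R) : 0 <= a -> pos a = a.
Proof. exact: max_l. Qed.

Lemma pos_le0 (R : realDomainType) (a : R) : a <= 0 -> pos a = 0.
Proof. exact: max_r. Qed.

Lemma flip_signs t k m :
  flip true t k m = flip false t k m + col t k *~ m (inl k).
Proof.
move: (col_diag t k); rewrite /flip; move: (col t k) => c c0.
apply/ffunP => i; rewrite !ffunE !ffunMzE mulrzz.
case: eqP => [->|_]; first by rewrite c0 mul0r addr0.
by rewrite -addrA; congr (_ + _); rewrite -mulrDl -{3}(pos_subN (c i)) addrC subrK.
Qed.

Lemma flip_basis_uf e t k :
  flip e t k (basis_vec (inl k))
  = if e then exch_vecP (exch t) k else exch_vecN (exch t) k.
Proof.
suff -> : flip e t k (basis_vec (inl k)) = - basis_vec (inl k)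
     + \sum_i basis_vec i *~ pos (if e then col t k i else - col t k i).
  by case: e.
rewrite (sum_basis (fun i => pos (if e then col t k i else - col t k i))).
move: (col_diag t k); rewrite /flip; move: (col t k) => c c0.
apply/ffunP => i; rewrite !ffunE eqxx eq_sym.
case: eqP => [<-|_]; last by rewrite mulr1 oppr0.
by rewrite c0 oppr0 if_same /pos maxxx addr0.
Qed.

Lemma flip_basis_neq e t k (i : V) : i != inl k -> flip e t k (basis_vec i) = basis_vec i.
Proof.
move=> ik; apply/ffunP => l; rewrite !ffunE (negPf ik) mulr0 addr0.
by case: eqP => [->|//]; rewrite (negPf ik) oppr0.
Qed.

(** The two signs differ by a shear along [col t k]. By compatibility, pairing with that column only
    sees the coordinate at [k], so the correction terms cancel. *)
Lemma flip_form e t k m m' :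
  form (lam (mutate k t)) m m' = form (lam t) (flip e t k m) (flip e t k m').
Proof.
rewrite [lam (mutate k t)]/= form_mutate -!flip_transport; case: e => //.
rewrite !flip_signs !formDl !formDr !formZl !formZr.
have uk n : flip false t k n (inl k) = - n (inl k) by rewrite !ffunE eqxx.
have := lam_compat t; rewrite /compatible; case: (flav D) => [L0|d' _ [LN LB]].
  have z n n' : form (lam t) n n' = 0.
    by rewrite /form big1 // => i _; rewrite big1 // => j _; rewrite L0 mulr0 mul0r.
  by rewrite !z !mul0r !addr0.
have uB n : form (lam t) n (col t k) = - (n (inl k) * (d' k)%:Z).
  rewrite {1}(lattice_basis n) form_suml (bigD1 (inl k)) //= big1 ?addr0.
    by rewrite formZl LB eqxx; ring.
  by move=> i /negPf ik; rewrite formZl LB ik mul0r.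
have Bu n : form (lam t) (col t k) n = n (inl k) * (d' k)%:Z.
  by rewrite formC // uB opprK.
rewrite !uB !Bu !uk col_diag; ring.
Qed.

Lemma col_mutate t k j i : col (mutate k t) j i =
  if (i == inl k) || (j == k) then - col t j i
  else col t j i + col t k i * pos (col t j (inl k))
       + pos (- col t k i) * col t j (inl k).
Proof. exact/column_mutate/exch_int. Qed.

(** Matrix mutation can be written with either sign, the two formulas differing by
    [pos x - pos (- x) = x]. *)
Lemma flip_col e t k j : flip e t k (col (mutate k t) j)
  = if j == k then - col t k
    else col t j + col t k *~ pos (if e then - col t j (inl k) else col t j (inl k)).
Proof.
have E : flip false t k (col (mutate k t) j)
    = if j == k then - col t k else col t j + col t k *~ pos (col t j (inl k)).
  by rewrite flip_transport mutate_column //; [exact: exch_int|exact: exch_skew].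
case: e => //; rewrite flip_signs E col_mutate eqxx /=.
case: eqP => [->|_]; first by rewrite col_diag oppr0 mulr0z addr0.
rewrite -addrA -mulrzDr; congr (_ + _ *~ _).
by rewrite -{2}(pos_subN (col t j (inl k))) opprB addrC subrK.
Qed.

(** The transformation is linear on each side of the wall [m (inl k) = 0]; on the wall the branches
    agree, so either sign is allowed there. *)
Lemma trop_flip e t k m : (0 < m (inl k) -> e) -> (m (inl k) < 0 -> ~~ e) ->
  trop k t m = flip e t k m.
Proof.
move=> mp mn; rewrite /trop /flip; move: (col t k) => c; apply/ffunP => i; rewrite !ffunE.
case: eqP => // _; move: (m i) (m (inl k)) mp mn => y x mp mn.
case: ltrgt0P mp mn => [m0 /(_ isT) -> _|m0 _ /(_ isT) /negPf ->|-> _ _].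
- by rewrite (pos_ge0 (ltW m0)) (pos_le0 (a := - x)) ?oppr_le0 ?ltW // mulr0 subr0.
- by rewrite (pos_le0 (ltW m0)) (pos_ge0 (a := - x)) ?oppr_ge0 ?ltW // mulr0 addr0 mulrN opprK.
- by rewrite oppr0 (pos_le0 (lexx 0)) !mulr0 subr0.
Qed.

Lemma tropK t k m : trop k (mutate k t) (trop k t m) = m.
Proof.
apply/ffunP => i; rewrite [LHS]ffunE col_mutate eqxx orbT.
rewrite /trop; move: (col t k) => c; rewrite !ffunE eqxx opprK.
by case: (i == inl k); rewrite ?opprK //; ring.
Qed.

Lemma trop_eq_exch t t' k m : exch t =2 exch t' -> trop k t m = trop k t' m.
Proof. by move=> E; apply/ffunP => i; rewrite !ffunE !E. Qed.

Lemma mutate_eq_exch t t' k : exch t =2 exch t' ->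
  exch (mutate k t) =2 exch (mutate k t').
Proof. by move=> E i j; rewrite /= /mutate_exch !E. Qed.

(** Exchange matrices are compared pointwise, rather than seeds, since they alone determine the
    tropical transformations. *)
Lemma exch_mutateK t k : exch (mutate k (mutate k t)) =2 exch t.
Proof.
move=> i j; rewrite /= /mutate_exch !eqxx !orbT /=.
case: ((i == inl k) || (j == inl k)); first by rewrite opprK.
move: (exch t i j) (exch t i (inl k)) (exch t (inl k) j) => a x y.
rewrite opprK; move: (pos_subN x) (pos_subN y).
by move: (pos x) (pos (- x)) (pos y) (pos (- y)) => px nx py ny <- <-; ring.
Qed.

Lemma mutate_seq_rcons t ks k : mutate_seq t (rcons ks k) = mutate k (mutate_seq t ks).
Proof. by elim: ks t => //=. Qed.

Lemma exch_mutate_seqK t ks : exch (mutate_seq (mutate_seq t ks) (rev ks)) =2 exch t.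
Proof.
have mutate_seq_eq t1 t2 l : exch t1 =2 exch t2 ->
    exch (mutate_seq t1 l) =2 exch (mutate_seq t2 l).
  by elim: l t1 t2 => //= k l IH t1 t2 E; apply/IH/mutate_eq_exch.
elim: ks t => //= k ks IH t i j; rewrite rev_cons mutate_seq_rcons.
by rewrite (mutate_eq_exch _ (IH _)) exch_mutateK.
Qed.

Lemma trop_seq_rcons t ks k m :
  trop_seq t (rcons ks k) m = trop k (mutate_seq t ks) (trop_seq t ks m).
Proof. by elim: ks t m => //=. Qed.

Lemma trop_seqK t ks m :
  trop_seq (mutate_seq t ks) (rev ks) (trop_seq t ks m) = m.
Proof.
elim: ks t m => //= k ks IH t m.
by rewrite rev_cons trop_seq_rcons IH (trop_eq_exch _ _ (exch_mutate_seqK _ _)) tropK.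
Qed.

End Flip.

Local Arguments exch : simpl never.

(** * Composites of flips along a mutation sequence, selected by an order *)

Section Chart.
Context (D : fixed_data).
Local Notation V := (vertex D).
Local Notation M := (lattice D).
Implicit Types (t s : seed D) (k j : Iuf D) (m : M) (e : bool) (S : pred M).

Local Notation col t k := (column (exch t) k).

Lemma flipMz e t k m n : flip e t k (m *~ n) = flip e t k m *~ n.
Proof. exact: raddfMz. Qed.

Definition pull S e t k : pred M := fun m => S (flip e t k m).

Lemma pull_total S e t k : total_cone S -> total_cone (pull S e t k).
Proof.
case=> [[S0 SD SN] ST]; split; last by move=> a; rewrite /pull raddfN; apply: ST.
rewrite /pull; split=> [|a b Sa Sb|a Sa Sa']; first by rewrite raddf0.
  by rewrite raddfD; apply: SD.
apply: (inv_inj (flipK e t k)); rewrite raddf0; apply: SN => //.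
by rewrite -raddfN.
Qed.

(** The two exponents of the exchange relation differ by [col s k], so its sign for [S] tells which
    one dominates. Later mutations are governed by the order pulled back through the flip. *)
Fixpoint chart S s (ks : seq (Iuf D)) : M -> M :=
  if ks is k :: ks' then
    fun m => flip (S (col s k)) s k
               (chart (pull S (S (col s k)) s k) (mutate k s) ks' m)
  else id.

Lemma chart_is_additive S s ks : zmod_morphism (chart S s ks).
Proof.
by elim: ks S s => //= k ks IH S s m m'; rewrite IH raddfB.
Qed.

HB.instance Definition _ S s ks :=
  GRing.isZmodMorphism.Build M M (chart S s ks) (chart_is_additive S s ks).

Lemma chart_inj S s ks : injective (chart S s ks).
Proof.
elim: ks S s => [|k ks IH] S s /=; first exact: inj_id.
by move=> m m' /(inv_inj (flipK _ _ _)) /IH.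
Qed.

Lemma chart_form S s ks m m' :
  form (lam (mutate_seq s ks)) m m' = form (lam s) (chart S s ks m) (chart S s ks m').
Proof. by elim: ks S s => //= k ks IH S s; rewrite -flip_form; apply: IH. Qed.

Lemma chart_frozen S s ks (i : Ifr D) : chart S s ks (basis_vec (inr i)) = basis_vec (inr i).
Proof. by elim: ks S s => //= k ks IH S s; rewrite IH flip_basis_neq. Qed.

(* The rational linear independence of the columns of B~, in dual form. *)
Definition separated t : Prop := forall v : Iuf D -> int,
  exists N : int, exists l : {additive M -> int},
    0 < N /\ forall k, l (col t k) = N * v k.

Lemma separated_eq_exch t t' : exch t =2 exch t' -> separated t -> separated t'.
Proof.
move=> E ft v; have [N [l [N0 lv]]] := ft v; exists N, l; split=> // k.
by rewrite -lv; congr (l _); apply/ffunP => i; rewrite !ffunE E.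
Qed.

Lemma col_neq0 t k : separated t -> col t k != 0.
Proof.
case/(_ (fun=> 1)) => N [l [N0 lv]]; apply/eqP => k0.
by have := lv k; rewrite k0 raddf0 mulr1 => N0'; rewrite -N0' in N0.
Qed.

Lemma separated_mutate t k : separated t -> separated (mutate k t).
Proof.
move=> ft v; pose p j : int := pos (col t j (inl k)).
(* These values solve the triangular system given by [flip_col] for the form [l] composed with the
   flip. *)
have [N [l [N0 lv]]] := ft (fun j => if j == k then - v k else v j + p j * v k).
exists N, (l \o flip false t k : {additive M -> int}); split=> // j.
rewrite /= flip_col; case: eqP => [->|jk]; first by rewrite raddfN lv eqxx mulrN opprK.
by rewrite raddfD raddfMz !lv eqxx -/(p j); case: eqP => // _; rewrite -mulrzr intz; ring.
Qed.

(** The converse follows by mutating back along the reversed sequence. *)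
Lemma separated_mutate_seq t ks : separated (mutate_seq t ks) <-> separated t.
Proof.
have fwd t' l : separated t' -> separated (mutate_seq t' l).
  by elim: l t' => //= k l IH t' ft; apply/IH/separated_mutate.
split=> [ft|]; last exact: fwd.
exact: separated_eq_exch (@exch_mutate_seqK _ t ks) (fwd _ _ ft).
Qed.

Lemma lattice_ind (Q : M -> Prop) : Q 0 -> (forall m m', Q m -> Q m' -> Q (m + m')) ->
  (forall m, Q m -> Q (- m)) -> (forall i, Q (basis_vec i)) -> forall m, Q m.
Proof.
move=> Q0 QD QN QB m; rewrite (lattice_basis m).
apply: (big_ind Q) => // i _; move: (m i) => n.
have Qn (l : nat) : Q (basis_vec i *+ l).
  by elim: l => // l IH; rewrite mulrS; apply: QD.
by case: n => l; [apply: Qn | rewrite NegzE mulrNz; apply/QN/Qn].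
Qed.

End Chart.

(** * Leading terms under the mutation isomorphisms *)

Section LeadingMutation.
Context (D : fixed_data) (F : forall t : seed D, skew_fractions (LP t)).
Context (mu : forall k t, mutation_iso F k t).
Local Notation M := (lattice D).
Local Notation col t k := (column (exch t) k).
Implicit Types (t s : seed D) (k : Iuf D) (m : M) (S : pred M).

Lemma flip_bich e t k m m' :
  seed_bicharacter (mutate k t) m m' = seed_bicharacter t (flip e t k m) (flip e t k m').
Proof. by rewrite /= (flip_form e). Qed.

Lemma monomialM t m m' : monomial t m * monomial t m'
  = scalar t (seed_bicharacter t m m') * monomial t (m + m').
Proof. by rewrite !ta_mulE !ta_mulUU bich0l add0r !mulr1 mul1r. Qed.

Lemma scalarM t r r' : scalar t r * scalar t r' = scalar t (r * r').
Proof. by rewrite !ta_mulE !ta_mulUU bich0l addr0 mulr1. Qed.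

Lemma scalar1 t : scalar t 1 = 1. Proof. by []. Qed.

Lemma scalar_monomial t r m : scalar t r * monomial t m = << r *g m >>.
Proof. by rewrite !ta_mulE !ta_mulUU bich0l add0r !mulr1. Qed.

Lemma monomial0 t : monomial t 0 = 1. Proof. by []. Qed.

Lemma leading_scalar S t r : total_cone S -> r != 0 ->
  leading (c := seed_bicharacter t) S (scalar t r) (scalar t r).
Proof.
move=> [[S0 _ _] _] r0; exists r, 0; split=> //; split=> [|h].
  by rewrite mcoeffUU.
by rewrite msuppU (negPf r0) inE => /eqP ->; rewrite subrr.
Qed.

Lemma unit_neq0 (R : nzRingType) (x y : R) : x * y = 1 -> x != 0.
Proof. by move=> xy; apply/eqP => x0; have := oner_neq0 R; rewrite -xy x0 mul0r eqxx. Qed.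

Lemma frac_leading_scale S t r r' (x : F t) u : total_cone S -> r' * r = 1 ->
  frac_leading S (emb (F t) (scalar t r) * x) (scalar t r * u) -> frac_leading S x u.
Proof.
move=> ST rr' xu; have r'0 := unit_neq0 rr'.
have := frac_leading_mul ST (frac_leading_emb ST (leading_scalar t ST r'0)) xu.
by rewrite !mulrA -rmorphM scalarM rr' scalar1 rmorph1 !mul1r.
Qed.

(** The flip preserves the twist, and leading terms multiply and divide, so the valid exponents [m]
    form a subgroup and basis vectors suffice. At [k], the exponents of the exchange relation differ
    by the nonzero [col t k], so exactly one of them leads. *)
Lemma leading_mutate_monomial S t k m : total_cone S -> separated t ->
  frac_leading S (mu k t (emb (F (mutate k t)) (monomial (mutate k t) m)))
    (monomial t (flip (S (col t k)) t k m)).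
Proof.
move=> ST ft; set e := S (col t k).
pose Q m := frac_leading S (mu k t (emb (F (mutate k t)) (monomial (mutate k t) m)))
    (monomial t (flip e t k m)).
apply: (lattice_ind (Q := Q)).
- rewrite /Q raddf0 !monomial0 !rmorph1 -(rmorph1 (emb (F t))).
  exact/frac_leading_emb/leading_one.
- move=> m1 m2 Q1 Q2.
  have [r rP] := bich_unit (seed_bicharacter (mutate k t)) m1 m2.
  apply: (frac_leading_scale ST rP).
  rewrite -(mu_scalar (mu k t)) -!rmorphM -monomialM (flip_bich e) raddfD -monomialM !rmorphM.
  exact: frac_leading_mul.
- move=> m1 Q1; apply: (frac_leading_div ST Q1).
  rewrite -!rmorphM !monomialM addNr raddfN addNr !monomial0 !mulr1 mu_scalar.
  rewrite (flip_bich e) raddfN.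
  apply/frac_leading_emb/leading_scalar => //.
  have [r rP] := bich_unit (seed_bicharacter t) (- flip e t k m1) (flip e t k m1).
  by rewrite mulrC in rP; apply: unit_neq0 rP.
- move=> i; rewrite /Q; have [->|ik] := eqVneq i (inl k); last first.
    rewrite mu_var // flip_basis_neq //.
    exact/frac_leading_emb/leading_monomial.
  rewrite mu_exch flip_basis_uf; apply: frac_leading_emb => //.
  have E : exch_vecP (exch t) k - exch_vecN (exch t) k = col t k.
    have := flip_signs t k (basis_vec (inl k)); rewrite !flip_basis_uf => ->.
    by rewrite ffunE eqxx mulr1z addrC addKr.
  have [Lp Ln] := (leading_monomial (seed_bicharacter t) ST (exch_vecP (exch t) k),
                   leading_monomial (seed_bicharacter t) ST (exch_vecN (exch t) k)).
  have ne := col_neq0 k ft; rewrite -E subr_eq0 in ne.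
  rewrite /e; have [Sc|Sc] := boolP (S (col t k)); last first.
    apply: (leading_add ST Ln Lp); last by rewrite eq_sym.
    by case: ST => _ /(_ (col t k)); rewrite (negPf Sc) -E opprB.
  by rewrite addrC; apply: (leading_add ST Lp Ln); rewrite ?E.
Qed.

(** The flip is injective, and monotone for the pulled back order, so the images of the terms of [z]
    have distinct leading exponents and the top one cannot cancel. The induction removes the leading
    term of [z]. *)
Lemma leading_mutate_LP S t k (z : LP (mutate k t)) r m : total_cone S -> separated t ->
  let e := S (col t k) in
  leading (c := seed_bicharacter (mutate k t)) (pull S e t k) z << r *g m >> ->
  frac_leading S (mu k t (emb (F (mutate k t)) z)) << r *g flip e t k m >>.
Proof.
move=> ST ft e; have PT := pull_total e t k ST.
have term r' m' : r' != 0 -> frac_leading S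
    (mu k t (emb (F (mutate k t)) << r' *g m' >>)) << r' *g flip e t k m' >>.
  move=> r0; rewrite -scalar_monomial -(scalar_monomial t) !rmorphM mu_scalar.
  apply: (frac_leading_mul ST); last exact: leading_mutate_monomial.
  exact/frac_leading_emb/leading_scalar.
have [n] := ubnP #|` msupp z|; elim: n z r m => // n IH z r m sz zl.
have r0 : r != 0 by have := leading_term_neq0 zl; rewrite monalgU_eq0.
have [zc zP] : topped (c := seed_bicharacter (mutate k t)) (fun h => pull S e t k h) z r m.
  have [r1 [m1 [r10 E zt]]] := zl.
  have Em : m1 = m.
    apply/eqP; apply: contra_neqT r10 => mm.
    by move/(congr1 (mcoeff m1)): E; rewrite mcoeffUU mcoeffU eq_sym (negPf mm).
  by move: E zt; rewrite Em => /(congr1 (mcoeff m)); rewrite !mcoeffUU => ->.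
pose z2 : LP (mutate k t) := z - << r *g m >>.
have zE : z = (<< r *g m >> : LP (mutate k t)) + z2 by rewrite addrC subrK.
have z2E h : z2@_h = if h == m then 0 else z@_h.
  rewrite mcoeffB mcoeffU eq_sym.
  by case: eqP => [->|_]; rewrite ?zc ?subrr ?subr0.
have [z20|z20] := eqVneq z2 0; first by rewrite zE z20 addr0; apply: term.
have [u z2u] := @leading_exists _ _ (seed_bicharacter (mutate k t)) _ PT _ z20.
have [r2 [m2 [r20 uE [z2c _]]]] := z2u; subst u.
have m2m : m2 != m by apply: contra_neq r20 => m2m; rewrite -z2c z2E m2m eqxx.
have zm2 : m2 \in msupp z.
  by rewrite -mcoeff_neq0; move: r20; rewrite -z2c z2E (negPf m2m).
rewrite zE rmorphD rmorphD; apply: (frac_leading_add ST (term _ _ r0)).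
- apply: IH z2u; rewrite ltnS in sz; apply: leq_trans _ sz.
  apply: fproper_ltn_card; rewrite fproperE; apply/andP; split.
    by apply/fsubsetP => h; rewrite -!mcoeff_neq0 z2E; case: ifP; rewrite ?eqxx.
  by apply/fsubsetPn; exists m; rewrite -?mcoeff_neq0 ?zc // negbK z2E eqxx.
- by rewrite -raddfB; apply: zP.
- by rewrite (inj_eq (inv_inj (flipK _ _ _))) eq_sym.
Qed.

(** Numerator and denominator are Laurent polynomials, so their images have known leading terms,
    which are then divided. *)
Lemma leading_mutate_frac S t k x m : total_cone S -> separated t ->
  let e := S (col t k) in
  frac_leading (K := F (mutate k t)) (pull S e t k) x (monomial (mutate k t) m) ->
  frac_leading S (mu k t x) (monomial t (flip e t k m)).
Proof.
move=> ST ft e [a [b [v [bv au xb]]]]; have [r [h [r0 vE _]]] := bv; subst v.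
have := leading_mutate_LP ST ft bv.
move: au; rewrite ta_mulE ta_mulUU mul1r => /(leading_mutate_LP ST ft) la lb.
apply: (frac_leading_div ST lb); rewrite -rmorphM xb.
by rewrite ta_mulE ta_mulUU mul1r -flip_bich -raddfD.
Qed.

Lemma leading_monomial_seq S s ks m : total_cone S -> separated s ->
  frac_leading S
    (mu_seq mu s ks (emb (F (mutate_seq s ks)) (monomial (mutate_seq s ks) m)))
    (monomial s (chart S s ks m)).
Proof.
elim: ks S s => [|k ks IH] S s ST fs /=.
  exact/frac_leading_emb/leading_monomial.
apply: (leading_mutate_frac ST fs); apply: IH; first exact: pull_total.
exact: separated_mutate.
Qed.

End LeadingMutation.

(** * Maximal elements of finite sets for the order of a cone *)

Section MoreCones.
Context (A : zmodType) (P : A -> Prop) (cP : pointed_cone P).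

(** If [h] is not maximal, it is discarded from the list and the search continues from a larger
    element. *)
Lemma cone_maximal_above (s : seq A) h : h \in s ->
  exists g, [/\ g \in s, P (g - h) & forall a, a \in s -> P (a - g) -> a = g].
Proof.
case: (cP) => P0 PD PN.
have [n] := ubnP (size s); elim: n s h => // n IH s h sz hs.
have [hmax|nmax] := classic (forall a, a \in s -> P (a - h) -> a = h).
  by exists h; rewrite subrr.
have [a [as_ Pah ah]] : exists a, [/\ a \in s, P (a - h) & a <> h].
  apply: NNPP => no; apply: nmax => a as_ Pah; apply: NNPP => ah.
  by apply: no; exists a.
have a' : a \in [seq b <- s | b != h] by rewrite mem_filter as_ andbT; apply/eqP.
have [|g [gs Pga gmax]] := IH _ _ _ a'.
  rewrite ltnS in sz; apply: leq_trans _ sz.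
  rewrite size_filter -(count_predC (pred1 h) s) -[X in (X < _)%N]add0n ltn_add2r.
  by rewrite -has_count has_pred1.
have Pgh : P (g - h) by rewrite -(subrKA a); apply: PD.
move: gs; rewrite mem_filter => /andP [gh gs].
exists g; split=> // b bs Pbg; have [bh|bh] := eqVneq b h.
  subst b; case/eqP: gh; apply/eqP; rewrite -subr_eq0; apply/eqP/PN => //.
  by rewrite opprB.
by apply: gmax => //; rewrite mem_filter bh.
Qed.

(** Each element lies below some maximal one, which can only be [g]. This turns a unique maximal
    degree into a greatest one. *)
Lemma cone_unique_maximal (s : seq A) g :
  (forall g', g' \in s -> (forall a, a \in s -> P (a - g') -> a = g') -> g' = g) ->
  forall h, h \in s -> P (g - h).
Proof. by move=> uniq h /cone_maximal_above [g' [gs Pgh /uniq <-]]. Qed.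

End MoreCones.

(** * Lexicographic group orders built from linear forms *)

Section LexCone.
Context (A : zmodType).
Implicit Types (l : {additive A -> int}) (ls : seq {additive A -> int}).

(** An element killed by all the forms counts as nonnegative; for a faithful list, only 0 is. *)
Fixpoint lexcone ls (a : A) : bool :=
  if ls is l :: ls' then (0 < l a) || (l a == 0) && lexcone ls' a else true.

Lemma lexcone_total ls :
  (forall a, (forall l : {additive A -> int}, List.In l ls -> l a = 0) -> a = 0) ->
  total_cone (lexcone ls).
Proof.
move=> faithful; split; first split.
- by elim: ls {faithful} => //= l ls ->; rewrite raddf0 eqxx orbT.
- elim: ls {faithful} => //= l ls IH a b; rewrite raddfD.
  case/orP => [la|/andP [/eqP -> Sa]] /orP [lb|/andP [/eqP -> Sb]].
  + by rewrite addr_gt0.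
  + by rewrite addr0 la.
  + by rewrite add0r lb.
  + by rewrite addr0 eqxx IH ?orbT.
- move=> a Sa Sa'; apply: faithful; elim: ls Sa Sa' => //= l ls IH.
  rewrite raddfN oppr_gt0 oppr_eq0 => S1 S2.
  have l0 : l a = 0.
    case/orP: S1 S2 => [la /orP [la'|/andP [/eqP //]]|/andP [/eqP //]].
    by move: (lt_trans la la'); rewrite ltxx.
  move: S1 S2; rewrite l0 eqxx ltxx /= => S1 S2 l' [<- //|]; exact: IH.
- elim: ls {faithful} => //= l ls IH a; rewrite raddfN oppr_gt0 oppr_eq0.
  by case: ltrgt0P => //= _; apply: IH.
Qed.

End LexCone.

(** * Dominance orders as pointed cones *)

Section Dominance.
Context (D : fixed_data).
Local Notation V := (vertex D).
Local Notation M := (lattice D).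
Implicit Types (t s : seed D) (k j : Iuf D) (m g : M) (S : pred M).
Implicit Types (l : {additive M -> int}).
Local Notation col t k := (column (exch t) k).

Definition coord (i : V) (m : M) : int := m i.

Lemma coord_is_additive i : zmod_morphism (coord i).
Proof. by move=> m m'; rewrite /coord !ffunE. Qed.

HB.instance Definition _ i := GRing.isZmodMorphism.Build M int (coord i) (coord_is_additive i).

(** The coordinates come last, as tie-breakers that make the list faithful and the order total. *)
Definition refined_cone (ls : seq {additive M -> int}) : pred M :=
  lexcone (ls ++ [seq (coord i : {additive M -> int}) | i <- enum V]).

Lemma refined_cone_total ls : total_cone (refined_cone ls).
Proof.
apply: lexcone_total => a la; apply/ffunP => i; rewrite [RHS]ffunE.
apply: (la (coord i)); apply/List.in_or_app; right.
have : i \in enum V by rewrite mem_enum.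
by elim: (enum V) => //= j r IH; rewrite inE => /predU1P [->|/IH]; [left|right].
Qed.

Definition dominated t (a : M) : Prop :=
  exists n : Iuf D -> nat, a = - \sum_k col t k *+ n k.

Lemma dom_leE t g' g : dom_le t g' g <-> dominated t (g - g').
Proof.
split=> -[n e]; exists n.
  by rewrite e opprD addrA subrr add0r.
by rewrite -[LHS](subKr g) e opprK.
Qed.

(** For antisymmetry, a form with the same positive value on all columns forces the multiplicities
    of two opposite elements to vanish. *)
Lemma dominated_cone t : separated t -> pointed_cone (dominated t).
Proof.
move=> ft; split.
- by exists (fun=> 0%N); rewrite big1 ?oppr0.
- move=> _ _ [n ->] [n' ->]; exists (fun k => (n k + n' k)%N).
  by rewrite -opprD -big_split; congr (- _); apply/eq_bigr => k _; rewrite mulrnDr.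
- move=> _ [n ->] [n' /eqP]; rewrite eqr_opp => /eqP e.
  have [N [l [N0 lv]]] := ft (fun=> 1).
  have lsum (p : Iuf D -> nat) : l (\sum_k col t k *+ p k) = N * (\sum_k p k)%:R.
    rewrite raddf_sum natr_sum mulr_sumr; apply/eq_bigr => k _.
    by rewrite raddfMn /= lv mulr1 mulr_natr.
  have := congr1 l e; rewrite raddfN !lsum => e'.
  have n0 : (\sum_k n k)%N = 0%N by move: e' N0; nia.
  rewrite big1 ?oppr0 // => k _.
  have : (n k <= \sum_k n k)%N by rewrite (bigD1 k) //= leq_addr.
  by rewrite n0 leqn0 => /eqP ->.
Qed.

Lemma opp_cone (P : M -> Prop) : pointed_cone P -> pointed_cone (fun a => P (- a)).
Proof.
case=> P0 PD PN; split; first by rewrite oppr0.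
  by move=> a b Pa Pb; rewrite opprD; apply: PD.
by move=> a Pa Pa'; apply: PN => //; rewrite -[a]opprK.
Qed.

(** The support being finite, a unique maximal exponent is the greatest one. *)
Lemma has_degreeP t (z : LP t) g : separated t ->
  has_degree z g <-> g \in msupp z /\ forall h, h \in msupp z -> dominated t (g - h).
Proof.
move=> /dominated_cone cP; case: (cP) => P0 PD PN.
have maxE g' : maximal_degree z g' <-> g' \in msupp z /\
    forall a, a \in (msupp z : seq M) -> dominated t (a - g') -> a = g'.
  split=> -[gz gmax]; split=> // a az.
    move=> /dom_leE ga; apply: NNPP => ne; apply: (gmax a az); split=> // e.
    by apply: ne; rewrite e.
  by case=> /dom_leE ga; apply => /=; rewrite (gmax a az ga).
split=> [[/maxE [gz _] gmax]|[gz gP]].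
  split=> //; apply: (cone_unique_maximal cP (s := msupp z)) => g' gz' gP'.
  by apply/gmax/maxE.
have gm a : a \in msupp z -> dominated t (a - g) -> a = g.
  move=> az Pag; apply/eqP; rewrite -subr_eq0; apply/eqP; apply: PN => //.
  by rewrite opprB; apply: gP.
split; first by apply/maxE.
by move=> g' /maxE [gz' gmax]; apply/esym/gmax => //; apply: gP.
Qed.

Lemma has_codegreeP t (z : LP t) g : separated t ->
  has_codegree z g <-> g \in msupp z /\ forall h, h \in msupp z -> dominated t (h - g).
Proof.
move=> /dominated_cone/opp_cone cP; case: (cP) => P0 PD PN.
have minE g' : minimal_degree z g' <-> g' \in msupp z /\
    forall a, a \in (msupp z : seq M) -> dominated t (- (a - g')) -> a = g'.
  split=> -[gz gmax]; split=> // a az.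
    rewrite opprB => /dom_leE ga; apply: NNPP => ne; exact: (gmax a az).
  by case=> /dom_leE ga; apply; apply: (gmax a az); rewrite opprB.
split=> [[/minE [gz _] gmax]|[gz gP]].
  split=> // h hz; rewrite -opprB.
  apply: (cone_unique_maximal cP (s := msupp z)) hz => g' gz' gP'.
  by apply/gmax/minE.
have gm a : a \in msupp z -> dominated t (- (a - g)) -> a = g.
  move=> az Pag; apply/eqP; rewrite -subr_eq0; apply/eqP; apply: PN => //.
  by rewrite opprK; apply: gP.
split; first by apply/minE.
by move=> g' /minE [gz' gmax]; apply/esym/gmax => //; rewrite opprB; apply: gP.
Qed.

(** A rational left inverse of the matrix turns prescribed values on the columns into a row vector,
    and [N] clears its denominators. *)
Lemma full_rank_separated t : full_rank t -> separated t.
Proof.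
rewrite /full_rank; set B := \matrix_(i, k) _ => rB v.
have /row_fullP [B' B'B] : row_full B by rewrite /row_full rB.
pose u : 'rV[rat]_#|V| := (\row_k (v (enum_val k))%:~R) *m B'.
pose N : int := \prod_i denq (u 0 i).
have N0 : 0 < N by apply: prodr_gt0 => i _; apply: denq_gt0.
have uN i : exists a : int, u 0 i * N%:~R = a%:~R.
  exists (numq (u 0 i) * \prod_(j | j != i) denq (u 0 j)).
  rewrite /N (bigD1 i) //= !rmorphM mulrA; congr (_ * _).
  by rewrite /= numqE.
have [a aP] : exists a : 'I_#|V| -> int, forall i, u 0 i * N%:~R = (a i)%:~R.
  by exists (fun i => Num.floor (u 0 i * N%:~R)) => j; have [b ->] := uN j; rewrite intrKfloor.
pose l (m : M) : int := \sum_i a i * m (enum_val i).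
have l_add : zmod_morphism l.
  move=> m m'; rewrite /l -sumrB; apply/eq_bigr => i _.
  by rewrite !ffunE mulrBr.
exists N; exists (HB.pack_for {additive M -> int} l
  (GRing.isZmodMorphism.Build M int l l_add)); split=> // k /=.
apply: (@intr_inj rat); rewrite /l rmorph_sum rmorphM /=.
have := congr1 (fun X : 'M_(_, _) => X 0 (enum_rank k))
  (mulmxA (\row_k (v (enum_val k))%:~R) B' B).
rewrite B'B mulmx1 mxE enum_rankK => ->; rewrite -/u mxE mulr_sumr; apply/eq_bigr => i _.
rewrite rmorphM /= -aP columnE; last exact: exch_int.
by rewrite [B _ _]mxE enum_rankK; ring.
Qed.

End Dominance.

(** * Charts compared with tropical transformations *)

Section Reachable.
Context (D : fixed_data).
Local Notation V := (vertex D).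
Local Notation M := (lattice D).
Implicit Types (t s : seed D) (k j : Iuf D) (m g : M) (S : pred M).
Implicit Types (l : {additive M -> int}).
Local Notation col t k := (column (exch t) k).

Lemma col_skew t j k :
  col t j (inl k) * (mult (inl j : V))%:Z = - (col t k (inl j) * (mult (inl k : V))%:Z).
Proof.
apply: (@intr_inj rat); rewrite rmorphN !rmorphM /= !columnE; try exact: exch_int.
exact: exch_skew.
Qed.

Lemma posM (a x : int) : 0 <= a -> a * pos x = pos (a * x).
Proof. by move=> a0; rewrite /pos maxr_pMr // mulr0. Qed.

(* By [col_skew] the weights [w] make [w k * b_kj] skew-symmetric in [j] and [k]. *)
Definition balanced (w : Iuf D -> int) : Prop :=
  (forall k, 0 < w k) /\
  (forall j k, w j * (mult (inl j : V))%:Z = w k * (mult (inl k : V))%:Z).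

Lemma balanced_skew w t j k : balanced w -> w k * col t j (inl k) = - (w j * col t k (inl j)).
Proof.
move=> [_ wE]; have dj : (mult (inl j : V))%:Z != 0 by rewrite lt0r_neq0 // ltz_nat mult_gt0.
apply: (mulIf dj); rewrite mulNr -mulrA col_skew mulrN mulrCA -[in RHS]mulrA.
rewrite [col t k (inl j) * _ in RHS]mulrC [in RHS]mulrA (wE j k); ring.
Qed.

(** Since [l] takes the value [w k * m (inl k)] on [col s k], the sign chosen by [S] selects the
    tropical branch at [m]; when that value is 0 the branches agree. Skew-symmetry, through
    [balanced_skew], preserves this hypothesis under mutation. Each flip then undoes one tropical
    step. *)
Lemma trop_chart w S s ks l m : total_cone S -> (forall a, 0 < l a -> S a) ->
  balanced w -> (forall k, l (col s k) = w k * m (inl k)) ->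
  chart S s ks (trop_seq s ks m) = m /\
  forall k, l (chart S s ks (col (mutate_seq s ks) k)) = w k * trop_seq s ks m (inl k).
Proof.
move=> + + wB; have [w0 wE] := wB.
elim: ks S s l m => [|k ks IH] S s l m ST lS lcol //=.
have SN a : l a < 0 -> ~~ S a.
  move=> la; apply/negP => Sa; case: ST => -[_ _ PN] _.
  suff a0 : a = 0 by rewrite a0 raddf0 ltxx in la.
  by apply: PN => //; apply: lS; rewrite raddfN oppr_gt0.
set e := S (col s k).
have tE : trop k s m = flip e s k m.
  apply: trop_flip => mk; first by apply: lS; rewrite lcol mulr_gt0.
  by apply: SN; rewrite lcol pmulr_rlt0.
have [|||mE lE] := IH (pull S e s k) (mutate k s) (l \o flip e s k : {additive M -> int})
    (trop k s m).
- exact: pull_total.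
- by move=> a; apply: lS.
- move=> j; have -> : trop k s m (inl j) = if j == k then - m (inl k)
      else m (inl j) + pos (if e then col s k (inl j) else - col s k (inl j)) * m (inl k).
    by rewrite tE [LHS]ffunE -[inl j == inl k]/(j == k); case: eqP => [->|].
  rewrite /= flip_col.
  case: (eqVneq j k) => [->|jk]; first by rewrite raddfN lcol mulrN.
  rewrite raddfD raddfMz !lcol mulrDr -mulrzr intz mulrAC; congr (_ + _).
  rewrite [RHS]mulrA; congr (_ * _); rewrite !posM ?ltW //; congr pos.
  by have := balanced_skew s j k wB; case: (e); rewrite ?mulrN => ->; rewrite ?opprK.
split; first by rewrite mE tE flipK.
by move=> j; rewrite -lE.
Qed.

(** By [flip_col], each flip sends columns to integer combinations of columns. The integrality of
    [C] is what later pins the coefficients down. *)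
Lemma chart_col_span S s ks k : exists C : Iuf D -> int,
  chart S s ks (col (mutate_seq s ks) k) = \sum_j col s j *~ C j.
Proof.
elim: ks S s => [|k' ks IH] S s /=.
  exists (fun j => (j == k)%:R); rewrite (bigD1 k) //= eqxx big1 ?addr0 //.
  by move=> j /negPf ->.
have [C ->] := IH (pull S (S (col s k')) s k') (mutate k' s); rewrite raddf_sum.
move: (S _) => e.
(* [p j] is the coefficient of [col s k'] in the flip of the [j]-th mutated column. *)
pose p j : int := if j == k' then -1
  else pos (if e then - col s j (inl k') else col s j (inl k')).
exists (fun j => if j == k' then \sum_i p i * C i else C j).
rewrite (bigD1 k') //= [RHS](bigD1 k') //= eqxx [\sum_i p i * C i](bigD1 k') //=.
rewrite mulrzDr -addrA; congr (_ + _).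
  by rewrite flipMz flip_col eqxx /p eqxx mulN1r mulrNz mulNrz.
rewrite mulrz_sumr -big_split /=; apply/eq_bigr => j /negPf jk.
by rewrite flipMz flip_col jk /p jk mulrzDl -mulrzA addrC.
Qed.

Definition refines S s : Prop := total_cone S /\ forall a, dominated s a -> S a.

Lemma refining_cone s l : separated s -> (forall k, l (col s k) <= 0) ->
  exists2 S, refines S s & forall a, 0 < l a -> S a.
Proof.
(* [l2] is negative on every column: it decides the sign of the dominated elements on which [l]
   vanishes. *)
move=> fs lcol; have [N [l2 [N0 l2col]]] := fs (fun=> -1).
exists (refined_cone [:: l; l2]); last by move=> a la; rewrite /refined_cone /= la.
split=> [|_ [n ->]]; first exact: refined_cone_total.
set a := - _.
have lE (l' : {additive M -> int}) : l' a = \sum_k (- l' (col s k)) *+ n k.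
  by rewrite /a raddfN raddf_sum -sumrN; apply/eq_bigr => k _; rewrite raddfMn mulNrn.
have la : 0 <= l a by rewrite lE sumr_ge0 // => k _; rewrite mulrn_wge0 // oppr_ge0.
have l2a : l2 a = N * (\sum_k n k)%:R.
  rewrite lE natr_sum mulr_sumr; apply/eq_bigr => k _.
  by rewrite l2col mulrN1 opprK mulr_natr.
have [n0|n0] := posnP (\sum_k n k)%N.
  have -> : a = 0.
    rewrite /a big1 ?oppr0 // => k _.
    have : (n k <= \sum_k n k)%N by rewrite (bigD1 k) //= leq_addr.
    by rewrite n0 leqn0 => /eqP ->.
  by have [[]] := @refined_cone_total D [:: l; l2].
rewrite /refined_cone /=; move: la; rewrite le_eqVlt eq_sym => /orP [la|->] //.
by rewrite la /= l2a mulr_gt0 ?ltr0n // orbT.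
Qed.

Lemma balanced_exists : exists w, balanced w.
Proof.
(* With this weight, [w k] times the multiplier of [k] is the product of all unfrozen
   multipliers. *)
exists (fun k => \prod_(j | j != k) (mult (inl j : V))%:Z); split=> [k|j k].
  by apply: prodr_gt0 => j _; rewrite ltz_nat mult_gt0.
transitivity (\prod_j (mult (inl j : V))%:Z).
  by rewrite [RHS](bigD1 j) //= mulrC.
by rewrite (bigD1 k) //= mulrC.
Qed.

Lemma additive_basis (f f' : {additive M -> M}) :
  (forall i, f (basis_vec i) = f' (basis_vec i)) -> f =1 f'.
Proof.
move=> E m; rewrite (lattice_basis m) !raddf_sum; apply/eq_bigr => i _.
by rewrite !raddfMz E.
Qed.

Lemma trop_seq_frozen t ks (i : Ifr D) :
  trop_seq t ks (basis_vec (inr i)) = basis_vec (inr i).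
Proof.
elim: ks t => //= k ks IH t; rewrite -[RHS](IH (mutate k t)); congr trop_seq.
by rewrite (@trop_flip _ false) ?flip_basis_neq // ffunE.
Qed.

(** Both sides have the same sum over [k], so no inequality is strict. *)
Lemma perm_le_eq (sigma : {perm Iuf D}) (w : Iuf D -> int) :
  (forall k, w (sigma k) <= w k) -> forall k, w (sigma k) = w k.
Proof.
move=> le k; apply/eqP; rewrite eq_le le /= leNgt; apply/negP => lt.
have : \sum_k w (sigma k) < \sum_k w k.
  by rewrite (bigD1 k) //= [X in _ < X](bigD1 k) //= ltr_leD // ler_sum.
by rewrite -(reindex_inj (h := sigma) (F := w) (P := xpredT) perm_inj) ltxx.
Qed.

End Reachable.

(** * The linear map attached to the shift *)

Section Shift.
Context (D : fixed_data) (F : forall t : seed D, skew_fractions (LP t)).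
Context (mu : forall k t, mutation_iso F k t).
Local Notation V := (vertex D).
Local Notation M := (lattice D).
Implicit Types (t s : seed D) (k j : Iuf D) (m g : M) (S : pred M).
Local Notation col t k := (column (exch t) k).

Lemma mu_seq_is_rmorphism s ks :
  (forall x y, mu_seq mu s ks (x + y) = mu_seq mu s ks x + mu_seq mu s ks y) /\
  (forall x y, mu_seq mu s ks (x * y) = mu_seq mu s ks x * mu_seq mu s ks y).
Proof.
elim: ks s => //= k ks IH s; have [hD hM] := IH (mutate k s).
by split=> x y; rewrite ?hD ?hM ?rmorphD ?rmorphM.
Qed.

Lemma mu_seqD s ks x y : mu_seq mu s ks (x + y) = mu_seq mu s ks x + mu_seq mu s ks y.
Proof. by case: (mu_seq_is_rmorphism s ks). Qed.

Lemma mu_seqM s ks x y : mu_seq mu s ks (x * y) = mu_seq mu s ks x * mu_seq mu s ks y.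
Proof. by case: (mu_seq_is_rmorphism s ks). Qed.

Lemma mu_seq0 s ks : mu_seq mu s ks 0 = 0.
Proof. by apply: (addIr (mu_seq mu s ks 0)); rewrite -mu_seqD !add0r. Qed.

Lemma mu_seq_sum s ks I (r : seq I) (f : I -> F (mutate_seq s ks)) :
  mu_seq mu s ks (\sum_(i <- r) f i) = \sum_(i <- r) mu_seq mu s ks (f i).
Proof. exact: (big_morph _ (@mu_seqD s ks) (mu_seq0 s ks)). Qed.

Lemma mu_seq_scalar s ks r :
  mu_seq mu s ks (emb (F (mutate_seq s ks)) (scalar (mutate_seq s ks) r))
  = emb (F s) (scalar s r).
Proof. by elim: ks s => //= k ks IH s; rewrite IH mu_scalar. Qed.

Lemma mu_seq_frozen s ks (i : Ifr D) :
  mu_seq mu s ks (emb (F (mutate_seq s ks)) (monomial (mutate_seq s ks) (basis_vec (inr i))))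
  = emb (F s) (monomial s (basis_vec (inr i))).
Proof. by elim: ks s => //= k ks IH s; rewrite IH mu_var. Qed.

Lemma chart_bich S s ks m m' :
  seed_bicharacter (mutate_seq s ks) m m'
  = seed_bicharacter s (chart S s ks m) (chart S s ks m').
Proof. by rewrite /= (chart_form S). Qed.

(** As [S] refines dominance, the degree of [z] is its leading exponent, computed by
    [leading_monomial_seq]. Since [g] does not involve [S], all refining orders give the same chart
    value. *)
Lemma degree_chart S s ks (z : LP s) g m : separated s -> refines S s ->
  emb (F s) z = mu_seq mu s ks (emb (F (mutate_seq s ks)) (monomial (mutate_seq s ks) m)) ->
  has_degree z g -> g = chart S s ks m /\ topped (c := seed_bicharacter s) (dominated s) z 1 g.
Proof.
move=> fs [ST Sdom] zE /(has_degreeP _ _ fs) [gz gP].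
have zl : leading (c := seed_bicharacter s) S z << z@_g *g g >>.
  by exists (z@_g), g; split; rewrite ?mcoeff_neq0 //; split=> // h /gP /Sdom.
have e : << z@_g *g g >> = monomial s (chart S s ks m).
  apply: (frac_leading_unique (K := F s) ST (frac_leading_emb ST zl)).
  by rewrite zE; apply: leading_monomial_seq.
have eg : g = chart S s ks m.
  apply/eqP; have := congr1 (mcoeff g) e; rewrite mcoeffUU mcoeffU eq_sym.
  by case: eqP => // _ /eqP; rewrite mulr0n -[_ == 0]negbK mcoeff_neq0 gz.
split=> //; split=> //.
by have := congr1 (mcoeff g) e; rewrite mcoeffUU mcoeffU -eg eqxx.
Qed.

Lemma shift_chart s ks : separated s -> is_shift mu s ks ->
  exists (G : {additive M -> M}) (sigma : {perm Iuf D}), let t := mutate_seq s ks in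
  [/\ injective G
    , forall i, exists z : LP s,
        emb (F s) z = mu_seq mu s ks (emb (F t) (monomial t (basis_vec i))) /\
        topped (c := seed_bicharacter s) (dominated s) z 1 (G (basis_vec i))
    , forall m m', seed_bicharacter t m m' = seed_bicharacter s (G m) (G m')
    , forall m, psi t (rev ks) m = G m
    & (forall i, G (basis_vec (inr i)) = basis_vec (inr i)) /\
      forall k, G (col t k) = - col s (sigma k)].
Proof.
move=> fs [sigma sh].
have [N0 [l0 [N00 l0E]]] := fs (fun=> -1).
have l0col k : l0 (col s k) <= 0 by rewrite l0E mulrN1 oppr_le0 ltW.
have [S0 rS0 _] := refining_cone fs l0col.
pose G : {additive M -> M} := chart S0 s ks.
have GE m : G m = chart S0 s ks m by [].
have Guf k j : G (basis_vec (inl k)) (inl j) = - (j == sigma k)%:R.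
  have [z [g [zE zg [h gh]]]] := sh k.
  have [e _] := degree_chart fs rS0 zE zg; rewrite GE -e gh !ffunE sum_ffunE big1.
    by rewrite addr0 eq_sym.
  by move=> i _; rewrite ffunMzE ffunE mul0rz.
(* Degrees do not depend on the order, so all these charts agree on basis vectors, hence
   everywhere. *)
have Gall S : refines S s -> chart S s ks =1 G.
  move=> rS; apply: additive_basis => -[k|i]; last first.
    exact: etrans (chart_frozen _ _ _ _) (esym (chart_frozen _ _ _ _)).
  have [z [g [zE zg _]]] := sh k.
  have [e _] := degree_chart fs rS zE zg; have [e0 _] := degree_chart fs rS0 zE zg.
  by rewrite GE -e0; exact: esym.
have [w wB] := balanced_exists D.
have main i : exists (N : int) (l : {additive M -> int}), [/\ 0 < N,
    forall k, l (col s k) = N * (w k * G (basis_vec (inl i)) (inl k)),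
    trop_seq s ks (G (basis_vec (inl i))) = basis_vec (inl i) &
    forall k, l (G (col (mutate_seq s ks) k)) = N * (w k * (k == i)%:R)].
  (* This form fits [trop_chart] for the degree [G f_i]. The unfrozen part of that degree is minus a
     basis vector, so the form is nonpositive on columns and some refining order begins with it. The
     factor [N] is absorbed into the weights. *)
  have [N [l [N_gt0 lE]]] := fs (fun k => w k * G (basis_vec (inl i)) (inl k)).
  have lcol k : l (col s k) <= 0.
    rewrite lE Guf mulrN mulrN oppr_le0 !mulr_ge0 ?ler0n ?ltW //.
    by case: wB.
  have [S rS lS] := refining_cone fs lcol.
  have NwB : balanced (fun k => N * w k).
    case: wB => w0 wE; split=> [k|j k]; first by rewrite mulr_gt0.
    by rewrite -!mulrA (wE j k).
  have lE' k : l (col s k) = N * w k * G (basis_vec (inl i)) (inl k) by rewrite lE mulrA.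
  have [e1 e2] := trop_chart ks rS.1 lS NwB lE'.
  have te : trop_seq s ks (G (basis_vec (inl i))) = basis_vec (inl i).
    by apply: (@chart_inj _ S s ks); rewrite e1 Gall.
  exists N, l; split=> // k; rewrite -(Gall S rS) e2 te ffunE mulrA eq_sym.
  by congr (_ * _).
exists G, sigma; split.
- exact: chart_inj.
- move=> [k|i].
    have [z [g [zE zg _]]] := sh k; exists z.
    by have [e zt] := degree_chart fs rS0 zE zg; rewrite GE -e.
  exists (monomial s (basis_vec (inr i))); rewrite mu_seq_frozen GE chart_frozen.
  by split=> //; apply: topped_monomial; case: (dominated_cone fs).
- exact: chart_bich.
- move=> m; rewrite [in RHS](lattice_basis m) raddf_sum; apply/eq_bigr => -[k|i] _.
    have [N [l [_ _ te _]]] := main k.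
    (* By [te] the tropical transformation sends [G f_k] to [f_k]; the reversed sequence sends [f_k]
       back. *)
    by rewrite raddfMz -{1}te trop_seqK.
  by rewrite raddfMz trop_seq_frozen GE chart_frozen.
split=> [i|]; first exact: chart_frozen.
have C_exists k : exists C : Iuf D -> int, G (col (mutate_seq s ks) k) = \sum_j col s j *~ C j.
  exact: chart_col_span.
(* The form attached to [i] vanishes on all columns of [s] but the one at [sigma i], so it isolates
   [C (sigma i)]. *)
have Cw k (C : Iuf D -> int) : G (col (mutate_seq s ks) k) = \sum_j col s j *~ C j ->
    forall i, - (w (sigma i) * C (sigma i)) = w k * (k == i)%:R.
  move=> CE i; have [N [l [N_gt0 lE _ lG]]] := main i.
  apply: (mulfI (lt0r_neq0 N_gt0)); rewrite -lG CE raddf_sum (bigD1 (sigma i)) //=.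
  rewrite big1 ?addr0 => [|j /negPf ji].
    by rewrite raddfMz lE Guf eqxx -mulrzr intz -[true%:R]/(1%:R); ring.
  by rewrite raddfMz lE Guf ji oppr0 !mulr0 mul0rz.
have wpos k : 0 < w k by case: wB.
(* The integer [- C (sigma k)] is positive, hence at least 1, so [w (sigma k) <= w k]; a permutation
   allows only equality, and then [C (sigma k)] is -1. *)
have wsigma : forall k, w (sigma k) = w k.
  apply: perm_le_eq => k; have [C /Cw /(_ k)] := C_exists k.
  rewrite eqxx mulr1 -mulrN => Ck; have := wpos k; rewrite -Ck pmulr_rgt0 // => C0.
  by apply: ler_peMr; [exact: ltW|rewrite -gtz0_ge1].
move=> k; have [C CE] := C_exists k; have E := Cw _ _ CE; rewrite CE.
rewrite (bigD1 (sigma k)) //= big1 ?addr0 => [|j jk].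
  have := E k; rewrite eqxx mulr1 -mulrN wsigma -[RHS]mulr1 => /(mulfI (lt0r_neq0 (wpos k))).
  by move/eqP; rewrite eqr_oppLR => /eqP ->; rewrite mulrN1z.
have [i ij] : exists i, j = sigma i by exists (sigma^-1%g j); rewrite permKV.
have ki : k == i = false by apply: contraNF jk => /eqP ->; rewrite ij.
have /eqP := E i; rewrite ki mulr0 oppr_eq0 mulf_eq0 gt_eqF // -ij /= => /eqP ->.
by rewrite mulr0z.
Qed.

End Shift.

(** * Division by a pointed element *)

Section ToppedDivision.
Context (A : zmodType) (k : comNzRingType) (c : bicharacter A k).
Local Notation TA := (twisted_algebra c).
Context (P : A -> Prop) (cP : pointed_cone P).

(** If [h] is maximal in the support of [z], only the pair [h], [p] contributes to the product at
    [h + p]. So [h + p] is in the support of the product, hence below [g + p]. *)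
Lemma topped_div (z x : TA) r g p : topped P x 1 p ->
  topped P (z * x : TA) (r * c g p) (g + p) -> topped P z r g.
Proof.
move=> [xp xP] [yg yP]; case: (cP) => P0 PD PN.
have coefE h : (forall a, a \in msupp z -> P (a - h) -> a = h) ->
    (z * x : TA)@_(h + p) = z@_h * c h p.
  move=> hmax; rewrite coef_mul_unique ?xp ?mulr1 // => a b az /xP Pb e.
  apply: hmax => //; suff -> : a - h = p - b by [].
  by apply/eqP; rewrite subr_eq addrAC eq_sym subr_eq e addrC.
have zP h : h \in msupp z -> P (g - h).
  move=> hz; have [h' [h'z Ph gmax]] := cone_maximal_above cP (s := msupp z) hz.
  rewrite -(subrKA h'); apply: PD Ph.
  suff /yP : h' + p \in msupp (z * x : TA) by rewrite opprD addrACA subrr addr0.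
  rewrite -mcoeff_neq0 coefE //; apply/eqP => e.
  move: h'z; rewrite -mcoeff_neq0 => /eqP; apply.
  by apply: (bich_cancel (c := c) (a := h') (b := p)); rewrite e mul0r.
split=> //; apply: (bich_cancel (c := c) (a := g) (b := p)).
rewrite -coefE // => a /zP Pa Pa'; apply/eqP; rewrite -subr_eq0; apply/eqP.
by apply: PN => //; rewrite opprB.
Qed.

End ToppedDivision.

(** * Codegrees in [t] against degrees in [s] *)

Section Comparison.
Context (D : fixed_data) (F : forall t : seed D, skew_fractions (LP t)).
Context (mu : forall k t, mutation_iso F k t).
Local Notation V := (vertex D).
Local Notation M := (lattice D).
Implicit Types (m g : M).
Local Notation col t k := (column (exch t) k).
Context (s : seed D) (ks : seq (Iuf D)).
Local Notation t := (mutate_seq s ks).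
Local Notation "'top' x" := (@topped _ _ (seed_bicharacter s) (dominated s) x)
  (at level 10, x at level 8).
Context (fs : separated s).
Context (G : {additive M -> M}) (sigma : {perm Iuf D}) (G_inj : injective G).
Context (Gvar : forall i, exists z : LP s,
  emb (F s) z = mu_seq mu s ks (emb (F t) (monomial t (basis_vec i))) /\
  top z 1 (G (basis_vec i))).
Context (Gbich : forall m m', seed_bicharacter t m m' = seed_bicharacter s (G m) (G m')).
Context (Gfr : forall i, G (basis_vec (inr i)) = basis_vec (inr i)).
Context (Gcol : forall k, G (col t k) = - col s (sigma k)).

Let cP : pointed_cone (dominated s) := dominated_cone fs.

Lemma dominated_chart a : dominated t a <-> dominated s (- G a).
Proof.
have E (n : Iuf D -> nat) : G (\sum_k col t k *+ n k) = - \sum_j col s j *+ n (sigma^-1%g j).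
  rewrite [in RHS](reindex_inj (h := sigma) perm_inj) raddf_sum -sumrN; apply/eq_bigr => k _.
  by rewrite raddfMn /= Gcol mulNrn permK.
split=> -[n e]; first by exists (fun j => n (sigma^-1%g j)); rewrite e raddfN E opprK.
exists (fun k => n (sigma k)); apply: G_inj; rewrite raddfN E opprK -[LHS]opprK e opprK.
by apply/eq_bigr => j _; rewrite permKV.
Qed.

Definition has_expansion m : Prop := exists x : LP s,
  emb (F s) x = mu_seq mu s ks (emb (F t) (monomial t m)) /\ top x 1 (G m).

Lemma has_expansionD m m' : has_expansion m -> has_expansion m' -> has_expansion (m + m').
Proof.
move=> [x [xE xt]] [x' [xE' xt']].
have [r rb] := bich_unit (seed_bicharacter t) m m'.
(* The scalar [r] cancels the twist between the two monomials. *)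
exists (scalar s r * (x * x')); split.
  rewrite !rmorphM xE xE' -(mu_seq_scalar mu s ks) -!mu_seqM -!rmorphM monomialM.
  by rewrite mulrA scalarM rb scalar1 mul1r.
have sr : top (scalar s r) r 0.
  split; first by rewrite mcoeffUU.
  by move=> h /(fsubsetP msuppU_le); rewrite inE => /eqP ->; rewrite subrr; case: cP.
have := topped_mul cP sr (topped_mul cP xt xt').
by rewrite !mul1r bich0l mulr1 -Gbich rb add0r -raddfD.
Qed.

Lemma has_expansion0 : has_expansion 0.
Proof.
exists 1; rewrite rmorph1 monomial0 rmorph1; split.
  by have := mu_seq_scalar mu s ks 1; rewrite !scalar1 !rmorph1.
by rewrite raddf0; apply: (topped_monomial (seed_bicharacter s)); case: cP.
Qed.

(** Negative exponents occur only at frozen vertices, whose variables are common to both seeds and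
    invertible in [LP s]. *)
Lemma has_expansion_nonneg m : (forall k, 0 <= m (inl k)) -> has_expansion m.
Proof.
have nat_mult m' (n : nat) : has_expansion m' -> has_expansion (m' *+ n).
  move=> h; elim: n => [|n IH]; first exact: has_expansion0.
  by rewrite mulrS; apply: has_expansionD.
move=> m0; rewrite (lattice_basis m).
apply: (big_ind has_expansion); [exact: has_expansion0|exact: has_expansionD|].
move=> [k|i] _.
  by rewrite -[m (inl k)]gez0_abs //; apply/nat_mult/Gvar.
case: (m (inr i)) => n; first by apply/nat_mult/Gvar.
rewrite NegzE mulrNz -mulNrz; apply: nat_mult.
exists (monomial s (- basis_vec (inr i))); split; last first.
  by rewrite raddfN Gfr; apply: topped_monomial; case: cP.
have [x [xE _]] := Gvar (inr i).
have inv t' : monomial t' (- basis_vec (inr i)) * monomial t' (basis_vec (inr i))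
   = scalar t' (seed_bicharacter t' (- basis_vec (inr i)) (basis_vec (inr i))).
  by rewrite monomialM addNr monomial0 mulr1.
have U : emb (F s) (monomial s (basis_vec (inr i))) \is a GRing.unit.
  by rewrite frac_unit // emb_eq0 monalgU_eq0 oner_eq0.
apply: (mulIr U); rewrite -[in RHS](mu_seq_frozen mu s ks) -mu_seqM -!rmorphM !inv.
by rewrite mu_seq_scalar Gbich raddfN Gfr.
Qed.

Lemma coef_scalar_mul (r : base_ring (flav D)) (x : LP s) h :
  (scalar s r * x)@_h = r * x@_h.
Proof.
rewrite -[h in LHS]add0r coef_mul_unique; first by rewrite mcoeffUU bich0l mulr1.
by move=> a b /(fsubsetP msuppU_le); rewrite inE => /eqP.
Qed.

Lemma copointed_chart (z : LP t) (z' : LP s) eta :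
  mu_seq mu s ks (emb (F t) z) = emb (F s) z' ->
  copointed z eta <-> pointed z' (G eta).
Proof.
move=> zz'; have ft : separated t by apply/separated_mutate_seq.
have [P0 PD PN] := cP.
(* [p] is large enough to make every [m + p] nonnegative, so all the monomials of [z] times that of
   [p] have expansions. *)
pose p : M := [ffun i => \sum_(m <- msupp z) `|m i|].
have p0 k : 0 <= p (inl k) by rewrite ffunE sumr_ge0.
have mp m k : m \in msupp z -> 0 <= (m + p) (inl k).
  move=> mz; rewrite !ffunE (big_fsetD1 m) //= addrA addr_ge0 ?sumr_ge0 //.
  by rewrite -lerBlDl sub0r; have := ler_norm (- m (inl k)); rewrite normrN.
have [X XP] : exists X : M -> LP s, forall m, (forall k, 0 <= m (inl k)) ->
    emb (F s) (X m) = mu_seq mu s ks (emb (F t) (monomial t m)) /\ top (X m) 1 (G m).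
  apply: (functional_choice (fun m x => (forall k, 0 <= m (inl k)) ->
    emb (F s) x = mu_seq mu s ks (emb (F t) (monomial t m)) /\ top x 1 (G m))) => m.
  have [m0|m0] := classic (forall k, 0 <= m (inl k)); last by exists 0.
  by have [x xP] := has_expansion_nonneg m0; exists x.
have [XpE Xpt] := XP p p0.
pose a m := z@_m * seed_bicharacter t m p.
have yE : z' * X p = \sum_(m <- msupp z) scalar s (a m) * X (m + p).
  apply: (@emb_inj _ (F s)); rewrite rmorphM XpE -zz' -mu_seqM -rmorphM.
  rewrite {1}(monalgE z) mulr_suml rmorph_sum mu_seq_sum rmorph_sum.
  rewrite !big_seq; apply/eq_bigr => m mz /=.
  have [XE _] := XP (m + p) (fun k => mp m k mz).
  rewrite [RHS]rmorphM XE -(mu_seq_scalar mu s ks) -mu_seqM -rmorphM scalar_monomial.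
  by rewrite ta_mulE ta_mulUU mulr1.
(* [G] reverses dominance: if no other exponent of [z] lies below [m], then no other [X (b + p)]
   reaches [G (m + p)]. *)
have coefE m : (forall b, b \in msupp z -> dominated t (m - b) -> b = m) ->
    (z' * X p)@_(G (m + p)) = a m.
  move=> mmin; rewrite yE raddf_sum /=.
  have E b : b \in msupp z -> (scalar s (a b) * X (b + p))@_(G (m + p)) = a b *+ (b == m).
    move=> bz; have [_ [Xc Xd]] := XP (b + p) (fun k => mp b k bz).
    rewrite coef_scalar_mul; case: eqP => [<-|bm]; first by rewrite Xc mulr1.
    rewrite (mcoeff_outdom (g := X (b + p))) ?mulr0 //; apply/negP => /Xd.
    rewrite -raddfB opprD addrACA subrr addr0 => Gd; apply/bm/mmin => //.
    by apply/dominated_chart; rewrite -raddfN opprB.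
  rewrite big_seq (eq_bigr _ E) -big_seq.
  have [mz|mz] := boolP (m \in msupp z).
    rewrite (big_fsetD1 m) //= eqxx big_seq big1 ?addr0 // => b.
    by rewrite in_fsetD1 => /andP [/negPf ->]; rewrite mulr0n.
  rewrite /a (mcoeff_outdom mz) mul0r big_seq big1 // => b bz.
  by case: eqP => // bm; rewrite -bm bz in mz.
have eta1 : a eta = z@_eta * seed_bicharacter s (G eta) (G p) by rewrite /a Gbich.
split.
- case=> /(has_codegreeP _ _ ft) [ez zmin] e1.
  have etamin b : b \in msupp z -> dominated t (eta - b) -> b = eta.
    move=> bz d; apply/eqP; rewrite -subr_eq0; apply/eqP.
    case: (dominated_cone ft) => _ _; apply; first exact: zmin.
    by rewrite opprB.
  have yt : top (z' * X p) (1 * seed_bicharacter s (G eta) (G p)) (G eta + G p).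
    split=> [|h]; first by rewrite -raddfD coefE // eta1 e1.
    rewrite yE -mcoeff_neq0 raddf_sum /= => hn.
    have [m [mz hm]] : exists m, m \in msupp z /\ h \in msupp (X (m + p)).
      apply: NNPP => no; case/eqP: hn; rewrite big_seq big1 // => m mz.
      rewrite coef_scalar_mul (mcoeff_outdom (g := X (m + p))) ?mulr0 //.
      by apply/negP => hm; apply: no; exists m.
    have [_ [_ /(_ _ hm) d1]] := XP (m + p) (fun k => mp m k mz).
    have /dominated_chart d2 := zmin m mz.
    have := PD _ _ d2 d1; rewrite -raddfN opprB addrA -raddfD -raddfD.
    by rewrite addrA subrK.
  have [zc zd] := topped_div cP Xpt yt.
  split=> //; apply/has_degreeP => //; split=> //.
  by rewrite -mcoeff_neq0 zc oner_eq0.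
- case=> /(has_degreeP _ _ fs) [_ z'd] e1.
  have [yc yd] := topped_mul cP (conj e1 z'd : top z' 1 (G eta)) Xpt.
  have zmin m : m \in msupp z -> dominated t (m - eta).
    (* A minimal exponent [m'] below [m] survives in the product at [G (m' + p)], which is therefore
       below [G (eta + p)]; hence [eta] is below [m']. *)
    move=> mz; have [m' [m'z Pm mmin]] :=
      cone_maximal_above (opp_cone (dominated_cone ft)) (s := msupp z) mz.
    rewrite -(subrKA m'); case: (dominated_cone ft) => _ QD _; apply: QD.
      by rewrite -opprB.
    apply/dominated_chart; rewrite -raddfN opprB.
    suff /yd : G (m' + p) \in msupp (z' * X p).
      by rewrite raddfD opprD addrACA subrr addr0 -raddfB.
    rewrite -mcoeff_neq0 coefE => [|b bz d]; last by apply: mmin => //; rewrite opprB.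
    apply/eqP => a0; move: m'z; rewrite -mcoeff_neq0 => /eqP; apply.
    apply: (bich_cancel (c := seed_bicharacter t) (a := m') (b := p)).
    by rewrite -/(a m') a0 mul0r.
  have ze : z@_eta = 1.
    apply: (bich_cancel (c := seed_bicharacter s) (a := G eta) (b := G p)).
    rewrite -eta1 -coefE; first by rewrite raddfD yc !mul1r.
    move=> b bz d; apply/eqP; rewrite -subr_eq0; apply/eqP.
    case: (dominated_cone ft) => _ _; apply; first exact: zmin.
    by rewrite opprB.
  split=> //; apply/has_codegreeP => //; split=> //.
  by rewrite -mcoeff_neq0 ze oner_eq0.
Qed.

End Comparison.

Theorem proposition3p3p12
  (D : fixed_data)
  (F : forall t : seed D, skew_fractions (LP t))
  (mu : forall (k : Iuf D) (t : seed D), mutation_iso F k t)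
  (s : seed D) (ks : seq (Iuf D)) :
  let t := mutate_seq s ks in
  forall (t_reachable : injective_reachable mu t)
         (s_shift : is_shift mu s ks)
         (t_full_rank : full_rank t)
         (z : LP t) (z' : LP s)
         (z'_def : mu_seq mu s ks (emb (F t) z) = emb (F s) z')
         (eta : lattice D),
  copointed z eta <-> pointed z' (psi t (rev ks) eta).
Proof.
(* Independence of the columns passes from [t] back to [s], where the orders are chosen. *)
move=> t _ s_shift /full_rank_separated/separated_mutate_seq fs z z' zz' eta.
have [G [sigma [G_inj Gvar Gbich -> [Gfr Gcol]]]] := shift_chart fs s_shift.
exact: (copointed_chart fs G_inj Gvar Gbich Gfr Gcol).
Qed.
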